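(* Let $\mathcal S$ be an operator system. If $\mathcal S$ has the weak expectation property (WEP), then $\mathcal S$ is $(\mathrm{el},\max)$-nuclear, i.e. $\mathcal S\otimes_{\mathrm{el}}\mathcal T=\mathcal S\otimes_{\max}\mathcal T$ for every operator system $\mathcal T$.
   Context: Operator system: a selfadjoint subspace of some $\mathcal B(H)$ containing the identity (equivalently, an abstract Choi–Effros operator system). Equality of two operator system structures on $\mathcal S\otimes\mathcal T$ means that the identity map is a complete order isomorphism. $I(\mathcal S)$ is the injective envelope of $\mathcal S$. Tensor products: $\max$: $u\in M_n(\mathcal S\otimes_{\max}\mathcal T)^+$ iff for every $r>0$, $u+r(1\otimes1)_n$ (where $(1\otimes 1)_n$ is the unit of $M_n(\mathcal S\otimes\mathcal T)$) has the form $A(P\otimes Q)A^*$ with $P\in M_k(\mathcal S)^+$, $Q\in M_m(\mathcal T)^+$, $A\in M_{n,km}$. $\mathrm{el}$: the structure on $\mathcal S\otimes\mathcal T$ from its inclusion in $I(\mathcal S)\otimes_{\max}\mathcal T$. WEP: the dual $\mathcal S^*$ is matrix ordered by $(f_{ij})\in M_n(\mathcal S^* )^+$ iff $s\mapsto(f_{ij}(s))\in M_n$ is completely positive; $\mathcal S^{**}$ carries the matrix order dual to that of $\mathcal S^*$ and is an operator system whose unit is the image of the unit of $\mathcal S$. $\mathcal S$ has WEP if the canonical inclusion $\mathcal S\to\mathcal S^{**}$ extends to a completely positive map $I(\mathcal S)\to\mathcal S^{**}$. *)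

(* Defs.v *)
From HB Require Import structures.
From mathcomp Require Import all_boot all_order all_algebra.
From mathcomp Require Import complex mxtens.
From mathcomp Require Import boolp classical_sets functions reals.

Set Implicit Arguments.
Unset Strict Implicit.
Unset Printing Implicit Defensive.

Import Order.TTheory GRing.Theory Num.Theory ComplexField.Normc.

Local Open Scope ring_scope.
Local Open Scope complex_scope.
Local Open Scope classical_set_scope.
Local Open Scope sesquilinear_scope.

Definition mcone (V : Type) := forall n : nat, set 'M[V]_n.

Definition completely_positive (V W : Type) (C : mcone V) (D : mcone W)
    (f : V -> W) : Prop :=
  forall n (X : 'M[V]_n), C n X -> D n (map_mx f X).

Definition complete_order_embedding (V W : Type) (C : mcone V) (D : mcone W)
    (f : V -> W) : Prop :=
  forall n (X : 'M[V]_n), C n X <-> D n (map_mx f X).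

Definition complete_order_isomorphism (V W : Type) (C : mcone V) (D : mcone W)
    (f : V -> W) : Prop :=
  completely_positive C D f /\
  exists g : W -> V,
    [/\ cancel f g, cancel g f & completely_positive D C g].

Section MatricesOverModule.
Context {R : realType} {V : lmodType R[i]}.

(* A X A^*, for X in M_n(V) and a scalar matrix A *)
Definition mxcongr m n (A : 'M[R[i]]_(m, n)) (X : 'M[V]_n) : 'M[V]_m :=
  \matrix_(i, j) \sum_k \sum_l (A i k * Num.conj (A j l)) *: X k l.

Definition diag_unit (e : V) n : 'M[V]_n := \matrix_(i, j) (e *+ (i == j)).

End MatricesOverModule.

(* Abstract operator systems, after Choi and Effros. Closure of the cones under
   multiplication by nonnegative reals is the case A = (sqrt r) I of mpos_congr.
   The carrier may be {0}, in which case the unit is 0. *)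
HB.mixin Record isOperatorSystem (R : realType) V of GRing.Lmodule R[i] V := {
  star : V -> V;
  mpos : mcone V;
  ounit : V;
  starK : involutive star;
  star_antilinear : forall (a : R[i]) (x y : V),
    star (a *: x + y) = Num.conj a *: star x + star y;
  mpos_herm : forall n (X : 'M[V]_n), mpos n X -> map_mx star X^T = X;
  mposD : forall n (X Y : 'M[V]_n), mpos n X -> mpos n Y -> mpos n (X + Y);
  mpos_proper : forall n (X : 'M[V]_n), mpos n X -> mpos n (- X) -> X = 0;
  mpos_congr : forall m n (A : 'M[R[i]]_(m, n)) (X : 'M[V]_n),
    mpos n X -> mpos m (mxcongr A X);
  ounit_herm : star ounit = ounit;
  ounit_order : forall n (X : 'M[V]_n), map_mx star X^T = X ->
    exists2 r : R, 0 < r & mpos n (diag_unit (r%:C *: ounit) n + X);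
  ounit_archimedean : forall n (X : 'M[V]_n),
    (forall r : R, 0 < r -> mpos n (diag_unit (r%:C *: ounit) n + X)) ->
    mpos n X }.

#[short(type="operatorSystemType")]
HB.structure Definition OperatorSystem (R : realType) :=
  { V of isOperatorSystem R V & GRing.Lmodule R[i] V }.

Arguments mpos {R s}.
Arguments ounit {R s}.

Section InjectiveEnvelope.
Context {R : realType}.

(* (S, j) is an operator subsystem of T, up to complete order isomorphism; j is
   injective because the cone of S is proper. *)
Definition subsystem_embedding (S T : operatorSystemType R)
    (j : {linear S -> T}) : Prop :=
  complete_order_embedding mpos mpos j /\ j ounit = ounit.

Definition injective_system (E : operatorSystemType R) : Prop :=
  forall (S T : operatorSystemType R) (j : {linear S -> T}),
    subsystem_embedding j ->
    forall phi : {linear S -> E}, completely_positive mpos mpos phi ->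
    exists2 psi : {linear T -> E},
      completely_positive mpos mpos psi & forall s, psi (j s) = phi s.

(* An injective system containing S, with no proper injective subsystem
   between S and itself. *)
Definition injective_envelope (S E : operatorSystemType R)
    (kappa : {linear S -> E}) : Prop :=
  [/\ subsystem_embedding kappa,
      injective_system E &
      forall (E1 : operatorSystemType R) (j : {linear E1 -> E}),
        subsystem_embedding j -> injective_system E1 ->
        range kappa `<=` range j -> range j = setT].

End InjectiveEnvelope.

(* Positivity in M_k(M_n) = M_(kn). *)
Section MatrixAlgebra.
Context {R : realType}.

Definition psdmx n (A : 'M[R[i]]_n) : Prop :=
  forall v : 'rV[R[i]]_n, 0 <= (v *m A *m v ^t Num.conj) 0 0.

Definition flatten_mx k n (X : 'M['M[R[i]]_n]_k) : 'M[R[i]]_(k * n) :=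
  \matrix_(p, q) X (mxtens_unindex p).1 (mxtens_unindex q).1
                   (mxtens_unindex p).2 (mxtens_unindex q).2.

Definition mx_mpos n : mcone 'M[R[i]]_n := fun k X => psdmx (flatten_mx X).

End MatrixAlgebra.

(* The space of functionals on V that are bounded with respect to N, together
   with its norm and with the matrix order dual to C. *)
Section Dual.
Context {R : realType} {V : lmodType R[i]}.
Implicit Types N : V -> R.

Definition bounded_functional N : {pred V -> R[i]^o} :=
  [pred f : V -> R[i]^o |
    `[< scalar f /\ exists M : R, forall x, normc (f x) <= M * N x >] ].

Record dual N := Dual {
  dual_fun :> V -> R[i]^o;
  dual_funP : dual_fun \in bounded_functional N }.

HB.instance Definition _ N := [isSub for @dual_fun N].
HB.instance Definition _ N := [Choice of dual N by <:].

Lemma bounded_functional_submod_closed N : submod_closed (bounded_functional N).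
Proof.
split.
  apply/asboolP; split; first by move=> a x y; rewrite /= mulr0 addr0.
  by exists 0 => x; rewrite normc0 mul0r.
move=> a f g /asboolP[lf [M hM]] /asboolP[lg [M' hM']].
apply/asboolP; split.
  move=> b x y; rewrite !fctE lf lg -![_ *: _]/(_ * _ : R[i]).
  by rewrite !mulrDr addrACA !mulrA (mulrC a b).
exists (normc a * M + M') => x; rewrite !fctE.
apply: le_trans (le_normcD _ _) _; rewrite mulrDl lerD //.
by rewrite normcM -mulrA ler_wpM2l// /normc; case: (a) => *; exact: sqrtr_ge0.
Qed.

HB.instance Definition _ N := GRing.isSubmodClosed.Build R[i] (V -> R[i]^o)
  (bounded_functional N) (bounded_functional_submod_closed N).
HB.instance Definition _ N := [SubChoice_isSubLmodule of dual N by <:].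

Definition dual_norm N (f : dual N) : R :=
  sup [set normc (f x) | x in [set x | N x <= 1]].

Definition dual_mpos N (C : mcone V) : mcone (dual N) := fun n F =>
  completely_positive C (@mx_mpos R n) (fun s => \matrix_(i, j) F i j s).

End Dual.

Section Bidual.
Context {R : realType} (S : operatorSystemType R).

(* The least r >= 0 such that the matrix (r1, s; s^*, r1) is positive in M_2(S);
   it is the norm of s in any unital complete order embedding into B(H). *)
Definition onorm (s : S) : R :=
  inf [set r : R | 0 <= r /\
    mpos (1 + 1) (block_mx (const_mx (r%:C *: ounit)) (const_mx s)
                           (const_mx (star s)) (const_mx (r%:C *: ounit)))].

Definition odual : lmodType R[i] := dual onorm.
Definition odual_mpos : mcone odual := dual_mpos (@mpos R S).

Definition obidual : lmodType R[i] := dual (@dual_norm R S onorm).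
Definition obidual_mpos : mcone obidual := dual_mpos odual_mpos.

End Bidual.
(* The image of s in the bidual is evaluation at s. That this is a bounded
   functional uses the order unit property in M_2(S). *)
Section CanonicalInclusion.
Context {R : realType} (S : operatorSystemType R).

Lemma onorm_scale_le1 (s : S) : exists2 r : R, 0 < r & onorm (r^-1%:C *: s) <= 1.
Proof.
pose X : 'M[S]_(1 + 1) :=
  block_mx (const_mx 0) (const_mx s) (const_mx (star s)) (const_mx 0).
have star0 : star (0 : S) = 0.
  have := star_antilinear (- 1) (0 : S) 0; rewrite scaler0 addr0 => ->.
  by rewrite rmorphN1 scaleN1r addNr.
have XH : map_mx star X^T = X.
  rewrite /X tr_block_mx map_block_mx !trmx_const !map_const_mx star0.
  by rewrite starK.
have [r r0 pr] := ounit_order (1 + 1) X XH.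
exists r => //; apply: ge_inf; first by exists 0 => z [].
split=> //.
pose c : R := Num.sqrt r^-1.
have := mpos_congr _ _ (c%:C%:M : 'M[R[i]]_(1 + 1)) _ pr.
have c2 : c%:C * Num.conj (c%:C) = r^-1%:C :> R[i].
  rewrite [Num.conj _]conjc_real -rmorphM /= -expr2 sqr_sqrtr //.
  by rewrite invr_ge0 ltW.
congr mpos; apply/matrixP => i j; rewrite mxE.
rewrite (bigD1 i) //= [X in _ + X]big1 ?addr0; last first.
  move=> k ki; rewrite big1 // => l _.
  by rewrite !mxE eq_sym (negbTE ki) mulr0n mul0r scale0r.
rewrite (bigD1 j) //= [X in _ + X]big1 ?addr0; last first.
  move=> k ki; rewrite !mxE [j == k]eq_sym (negbTE ki) mulr0n rmorph0.
  by rewrite mulr0 scale0r.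
rewrite ![(_%:M : 'M_(1 + 1)) _ _]mxE !eqxx !mulr1n c2.
rewrite [(_ + X) i j]mxE [diag_unit _ _ i j]mxE scalerDr /X.
have cr : r^-1%:C * r%:C = 1 :> R[i].
  by rewrite -rmorphM /= mulVf ?gt_eqF.
have starZ : star (r^-1%:C *: s) = r^-1%:C *: star s.
  have := star_antilinear r^-1%:C s 0; rewrite addr0 star0 addr0 => ->.
  by rewrite [Num.conj _]conjc_real.
case: (split_ordP i) => i' ->; case: (split_ordP j) => j' ->;
  rewrite !(block_mxEul, block_mxEur, block_mxEdl, block_mxEdr) !mxE
    ?eq_lshift ?eq_rshift ?eq_lrshift ?eq_rlshift.
- by rewrite (ord1 i') (ord1 j') eqxx mulr1n scaler0 addr0 scalerA cr rmorph1.
- by rewrite mulr0n scaler0 add0r.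
- by rewrite mulr0n scaler0 add0r starZ.
- by rewrite (ord1 i') (ord1 j') eqxx mulr1n scaler0 addr0 scalerA cr rmorph1.
Qed.

Fact canon_subproof (s : S) :
  (fun f : odual S => f s) \in bounded_functional (@dual_norm R S (@onorm R S)).
Proof.
apply/asboolP; split; first by [].
have [r r0 sr] := onorm_scale_le1 s.
exists r => f; have /asboolP[lf [M hM]] := dual_funP f.
have -> : f s = r%:C * f (r^-1%:C *: s) :> R[i].
  have := lf r^-1%:C s 0; rewrite addr0 => ->.
  have := lf (-1) (0 : S) 0; rewrite scaler0 addr0 mulN1r addNr => ->.
  by rewrite addr0 mulrA -rmorphM /= divff ?gt_eqF // mul1r.
have normcr : normc r%:C = r.
  by rewrite /= expr0n /= addr0 sqrtr_sqr gtr0_norm.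
rewrite normcM normcr ler_pM2l //; apply: ub_le_sup; last by exists (r^-1%:C *: s).
exists `|M| => _ [x xle <-]; apply: le_trans (hM x) _.
have x0 : 0 <= onorm x.
  rewrite /onorm; set E := [set _ | _].
  have [E0|/set0P E0] := eqVneq E set0; first by rewrite E0 inf0.
  by apply: lb_le_inf => // z [].
apply: le_trans (ler_norm _) _; rewrite normrM (ger0_norm x0).
by rewrite ler_piMr.
Qed.

Definition canonical_inclusion (s : S) : obidual S := Dual (canon_subproof s).

End CanonicalInclusion.

(* The algebraic tensor product, realized as the space spanned by the
   evaluations b |-> b(x, y) in the space of functionals on bilinear forms; see
   R. Ryan, Introduction to Tensor Products of Banach Spaces, Section 1. Scalars
   are absorbed in the first factor, so sums of evaluations suffice. *)
Section TensorProduct.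
Context {R : realType}.

Definition bilinear_form (S T : lmodType R[i]) := {bilinear S -> T -> R[i]^o}.

Definition tensor_span (S T : lmodType R[i]) :
    {pred bilinear_form S T -> R[i]^o} :=
  [pred u : bilinear_form S T -> R[i]^o |
    `[< exists p : seq (S * T), u = fun b => \sum_(xy <- p) b xy.1 xy.2 >] ].
Arguments tensor_span : clear implicits.

Record tensor (S T : lmodType R[i]) := Tensor {
  tensor_fun :> bilinear_form S T -> R[i]^o;
  tensor_funP : tensor_fun \in tensor_span S T }.

HB.instance Definition _ S T := [isSub for @tensor_fun S T].
HB.instance Definition _ S T := [Choice of tensor S T by <:].

Lemma tensor_span_submod_closed S T : submod_closed (tensor_span S T).
Proof.
split; first by apply/asboolP; exists [::]; apply/funext => b; rewrite big_nil.
move=> a _ _ /asboolP[p ->] /asboolP[q ->]; apply/asboolP.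
exists ([seq (a *: xy.1, xy.2) | xy <- p] ++ q); apply/funext => b.
rewrite big_cat big_map !fctE scaler_sumr; congr (_ + _).
by apply: eq_bigr => xy _ /=; rewrite linearZl_LR.
Qed.

HB.instance Definition _ S T := GRing.isSubmodClosed.Build R[i]
  (bilinear_form S T -> R[i]^o) (tensor_span S T)
  (tensor_span_submod_closed S T).
HB.instance Definition _ S T := [SubChoice_isSubLmodule of tensor S T by <:].

Fact elementary_subproof (S T : lmodType R[i]) (x : S) (y : T) :
  (fun b : bilinear_form S T => b x y) \in tensor_span S T.
Proof.
by apply/asboolP; exists [:: (x, y)]; apply/funext => b; rewrite big_seq1.
Qed.

Definition elementary (S T : lmodType R[i]) (x : S) (y : T) : tensor S T :=
  Tensor (elementary_subproof x y).

Section TensorMap.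
Context {S S' T T' : lmodType R[i]}.
Variables (f : {linear S -> S'}) (g : {linear T -> T'}).

Definition bilinear_comp (b : bilinear_form S' T') (x : S) (y : T) : R[i]^o :=
  b (f x) (g y).

Fact bilinear_comp_bilinear b : bilinear_for *:%R *:%R (bilinear_comp b).
Proof.
by split=> [y|x] a u v; rewrite /bilinear_comp /= linearP ?linearPl ?linearPr.
Qed.

HB.instance Definition _ b := bilinear_isBilinear.Build R[i] S T R[i]^o
  *:%R *:%R (bilinear_comp b) (bilinear_comp_bilinear b).

Fact tensor_map_subproof (u : tensor S T) :
  (fun b : bilinear_form S' T' => u (bilinear_comp b)) \in tensor_span S' T'.
Proof.
case: u => u /= /asboolP[p ->]; apply/asboolP.
exists [seq (f xy.1, g xy.2) | xy <- p]; apply/funext => b.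
by rewrite big_map.
Qed.

Definition tensor_map (u : tensor S T) : tensor S' T' :=
  Tensor (tensor_map_subproof u).

Lemma tensor_map_elementary x y :
  tensor_map (elementary x y) = elementary (f x) (g y).
Proof. exact: val_inj. Qed.

Fact tensor_map_linear : linear tensor_map.
Proof. by move=> a u v; apply: val_inj. Qed.

HB.instance Definition _ := GRing.isLinear.Build R[i] (tensor S T)
  (tensor S' T') _ tensor_map tensor_map_linear.

End TensorMap.

Definition mx_elementary (S T : lmodType R[i]) k m (P : 'M[S]_k) (Q : 'M[T]_m) :
    'M[tensor S T]_(k * m) :=
  \matrix_(p, q) elementary (P (mxtens_unindex p).1 (mxtens_unindex q).1)
                            (Q (mxtens_unindex p).2 (mxtens_unindex q).2).

End TensorProduct.

Section TensorStructures.
Context {R : realType}.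

Definition max_mpos (S T : operatorSystemType R) : mcone (tensor S T) :=
  fun n U => forall r : R, 0 < r ->
    exists k m (P : 'M[S]_k) (Q : 'M[T]_m) (A : 'M[R[i]]_(n, k * m)),
      [/\ mpos k P, mpos m Q &
          U + diag_unit (r%:C *: elementary ounit ounit) n
            = mxcongr A (mx_elementary P Q)].

(* The structure that S (x) T inherits from E (x)_max T along kappa : S -> E. *)
Definition el_mpos (S E : operatorSystemType R) (kappa : {linear S -> E})
    (T : operatorSystemType R) : mcone (tensor S T) :=
  fun n U => max_mpos (map_mx (tensor_map kappa (@idfun T)) U).

(* The injective envelope is unique up to a complete order isomorphism fixing S,
   so neither notion depends on the realization (E, kappa) of I(S). *)
Definition has_WEP (S : operatorSystemType R) : Prop :=
  exists (E : operatorSystemType R) (kappa : {linear S -> E}),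
    injective_envelope kappa /\
    exists2 Phi : {linear E -> obidual S},
      completely_positive mpos (@obidual_mpos R S) Phi &
      forall s, Phi (kappa s) = canonical_inclusion s.

Definition el_max_nuclear (S : operatorSystemType R) : Prop :=
  forall (E : operatorSystemType R) (kappa : {linear S -> E}),
    injective_envelope kappa ->
  forall T : operatorSystemType R,
    complete_order_isomorphism (@el_mpos S E kappa T) (@max_mpos S T) idfun.

End TensorStructures.

(* Main.v *)
Require Import Defs.
From mathcomp Require Import reals.
From HB Require Import structures.
From mathcomp Require Import all_boot all_order all_algebra.
From mathcomp Require Import complex mxtens.
From mathcomp Require Import boolp classical_sets functions.
From mathcomp Require Import ring lra.

(* Let Psi : I(S) -> S** be completely positive and extend the canonical
   inclusion, and suppose that U in M_n(S (x) T) is positive in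
   M_n(I(S) (x)_max T) but not in M_n(S (x)_max T). By Hahn-Banach there are
   bilinear forms beta_ij on S x T whose pairing with U, sum_ij U_ij(beta_ij), is
   not nonnegative although the pairing with every A(P (x) Q)A^* is. Positivity
   bounds each functional beta_ij(-, y) with respect to the norm of S, so it
   lies in S^* and beta'_ij(x, y) = Psi(x)(beta_ij(-, y)) is a bilinear form on
   I(S) x T that extends beta_ij. Complete positivity of Psi makes the pairing
   with beta' nonnegative on every A(P (x) Q)A^* over I(S), hence on U:
   a contradiction. Separation applies only to hermitian U; U is hermitian because
   its image is and kappa (x) id is injective. *)

Set Implicit Arguments.
Unset Strict Implicit.
Unset Printing Implicit Defensive.

Import Order.TTheory GRing.Theory Num.Theory ComplexField.Normc.

Local Open Scope ring_scope.
Local Open Scope complex_scope.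
Local Open Scope classical_set_scope.
Local Open Scope sesquilinear_scope.

(** * Linear functionals and complements *)

Section HahnBanach.
Context {R : realType} {V : lmodType R[i]}.
Implicit Types (p q : V -> R) (x y : V).

(** Only real scalars occur, since [p] is to dominate the real part of a complex functional. The
    inequality for all [r > 0] gives equality, by applying it to [r^-1] as well. *)
Definition real_sublinear p : Prop :=
  (forall x y, p (x + y) <= p x + p y) /\
  (forall r : R, 0 < r -> forall x, p (r%:C *: x) <= r * p x).

Lemma real_sublinearZ p (r : R) x : real_sublinear p -> 0 < r ->
  p (r%:C *: x) = r * p x.
Proof.
move=> [_ pZ] r0; apply/eqP; rewrite eq_le pZ//=.
have := pZ r^-1; rewrite invr_gt0 => /(_ r0 (r%:C *: x)).
rewrite scalerA -rmorphM mulVf ?gt_eqF// rmorph1 scale1r.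
by rewrite -(ler_pM2l r0) mulrA divff ?gt_eqF// mul1r.
Qed.

Lemma real_sublinear0 p : real_sublinear p -> p 0 = 0.
Proof.
move=> sp; have := @real_sublinearZ p 2 0 sp (ltr0n _ 2).
by rewrite scaler0; lra.
Qed.

Lemma real_sublinear_opp p x : real_sublinear p -> - p (- x) <= p x.
Proof.
move=> sp; have := sp.1 x (- x); rewrite subrr real_sublinear0//; lra.
Qed.

Lemma inf_sublinear (E : V -> set R) :
  (forall x, has_inf (E x)) ->
  (forall x y a b, E x a -> E y b -> exists2 c, E (x + y) c & c <= a + b) ->
  (forall (r : R) x a, 0 < r -> E x a ->
    exists2 c, E (r%:C *: x) c & c <= r * a) ->
  real_sublinear (fun x => inf (E x)).
Proof.
move=> Einf ED EZ; split=> [x y|r r0 x].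
  apply/ler_addgt0Pr => e e0; have e2 : 0 < e / 2 by lra.
  have [a Ea la] := inf_adherent e2 (Einf x).
  have [b Eb lb] := inf_adherent e2 (Einf y).
  have [c Ec lc] := ED _ _ _ _ Ea Eb.
  by have := ge_inf (Einf (x + y)).2 Ec; lra.
rewrite -ler_pdivrMl//; apply: lb_le_inf => [|a Ea]; first exact: (Einf x).1.
have [c Ec lc] := EZ _ _ _ r0 Ea.
by rewrite ler_pdivrMl// (le_trans _ lc)// ge_inf//; exact: (Einf _).2.
Qed.

(** For sublinear [p], the largest sublinear functional below [p] whose value at [- y] is at most
    [- p y]. A linear functional below it therefore takes the value [p y] at [y]. *)
Definition directional_inf p y x :=
  inf [set p (x + t%:C *: y) - t * p y | t in [set t : R | 0 <= t]].

Section DirectionalInf.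
Variables (p : V -> R) (y : V).
Hypothesis sp : real_sublinear p.

Lemma directional_inf_has_inf x : has_inf
  [set p (x + t%:C *: y) - t * p y | t in [set t : R | 0 <= t]].
Proof.
split; first by exists (p (x + 0%:C *: y) - 0 * p y), 0 => /=.
(* Subadditivity gives [t * p y <= p (x + t y) + p (- x)]. The case [t = 0] is apart because
   homogeneity is known for positive scalars only. *)
exists (- p (- x)) => _ [t /= t0 <-].
have := sp.1 (x + t%:C *: y) (- x); rewrite addrAC subrr add0r.
have [->|tN0] := eqVneq t 0.
  by rewrite mul0r rmorph0 scale0r addr0 real_sublinear0// subr0; lra.
by rewrite real_sublinearZ// ?lt_def ?tN0//; lra.
Qed.

Lemma directional_inf_le x : directional_inf p y x <= p x.
Proof.
apply: ge_inf; first exact: (directional_inf_has_inf x).2.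
by exists 0 => //=; rewrite rmorph0 scale0r addr0 mul0r subr0.
Qed.

Lemma directional_inf_le1 x : directional_inf p y x <= p (x + y) - p y.
Proof.
apply: ge_inf; first exact: (directional_inf_has_inf x).2.
by exists 1 => //=; rewrite rmorph1 scale1r mul1r.
Qed.

Lemma directional_inf_sublinear : real_sublinear (directional_inf p y).
Proof.
apply: inf_sublinear => [|x z _ _ [t /= t0 <-] [u /= u0 <-]|r x _ r0 [t /= t0 <-]].
- exact: directional_inf_has_inf.
- eexists; first by exists (t + u) => /=; [exact: addr_ge0|].
  have := sp.1 (x + t%:C *: y) (z + u%:C *: y).
  by rewrite addrACA -scalerDl -rmorphD; lra.
- eexists; first by exists (r * t) => /=; [rewrite mulr_ge0// ltW|].
  by rewrite rmorphM -scalerA -scalerDr real_sublinearZ//; lra.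
Qed.

End DirectionalInf.

(* Zorn's lemma is applied to sublinear functionals themselves rather than to
   partial linear extensions: a minimal one is additive, because it lies below
   each of its directional infima. *)
Lemma minimal_sublinear p : real_sublinear p ->
  exists q, [/\ real_sublinear q, forall x, q x <= p x &
    forall x y, q (x + y) = q x + q y].
Proof.
move=> sp.
pose T := {q : V -> R | real_sublinear q /\ forall x, q x <= p x}.
pose mk q (sq : real_sublinear q) (qp : forall x, q x <= p x) : T :=
  exist _ q (conj sq qp).
pose t0 : T := mk p sp (fun x => lexx (p x)).
(* The order is reversed, so that a maximal element for Zorn's lemma is a minimal functional. *)
pose le (s t : T) := `[< forall x, sval t x <= sval s x >].
have [||A Atot|[q [sq qp]] qmin] := @ZL_preorder T t0 le.
- by move=> t; apply/asboolP.
- move=> r s t /asboolP rs /asboolP st; apply/asboolP => x.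
  exact: le_trans (st x) (rs x).
- have [[a0 Aa0]|A0] := pselect (A !=set0); last first.
    by exists t0 => s As; case: A0; exists s.
  pose E x : set R := [set sval a x | a in A].
  have Einf x : has_inf (E x).
    split; first by exists (sval a0 x), a0.
    exists (- p (- x)) => _ [a _ <-].
    apply: le_trans (real_sublinear_opp x (svalP a).1).
    by rewrite lerN2; exact: (svalP a).2.
  have Ele a x : A a -> inf (E x) <= sval a x.
    by move=> Aa; apply: ge_inf; [exact: (Einf x).2|exists a].
  have sE : real_sublinear (fun x => inf (E x)).
    (* Of two members of the chain the smaller one, used at both [x] and [y], witnesses
       subadditivity of the infimum. *)
    apply: inf_sublinear => // [x y _ _ [a Aa <-] [b Ab <-]|r x _ r0 [a Aa <-]].
      have [/asboolP ab|/asboolP ba] := Atot _ _ Aa Ab.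
        exists (sval b (x + y)); first by exists b.
        by apply: le_trans ((svalP b).1.1 x y) _; rewrite lerD2r.
      exists (sval a (x + y)); first by exists a.
      by apply: le_trans ((svalP a).1.1 x y) _; rewrite lerD2l.
    exists (sval a (r%:C *: x)); first by exists a.
    exact: (svalP a).1.2.
  have Ep x : inf (E x) <= p x.
    exact: le_trans (Ele _ _ Aa0) ((svalP a0).2 x).
  by exists (mk _ sE Ep) => s As; apply/asboolP => x; exact: Ele.
exists q; split=> // x y; apply/eqP; rewrite eq_le sq.1 /=.
have dp z : directional_inf q y z <= p z.
  exact: le_trans (directional_inf_le y sq z) (qp z).
have := qmin (mk _ (directional_inf_sublinear y sq) dp).
have lqd : le (mk q sq qp) (mk _ (directional_inf_sublinear y sq) dp).
  by apply/asboolP => z; exact: directional_inf_le.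
move=> /(_ lqd) /asboolP /(_ x) /= h.
by have := directional_inf_le1 y sq x; lra.
Qed.

(** An additive sublinear [q] is real linear, and [q x - i q (i x)] is then complex linear with real
    part [q]. Taking [q] below [directional_inf p x0] instead of [p] forces equality at [x0]. *)
Lemma hahn_banach p x0 : real_sublinear p ->
  exists f : {linear V -> R[i]^o},
    (forall x, complex.Re (f x) <= p x) /\ complex.Re (f x0) = p x0.
Proof.
move=> sp.
have [q [sq qd qD]] := minimal_sublinear (directional_inf_sublinear x0 sp).
have qp x : q x <= p x := le_trans (qd x) (directional_inf_le x0 sp x).
have q0 : q 0 = 0 := real_sublinear0 sq.
have qN x : q (- x) = - q x by have := qD x (- x); rewrite subrr q0; lra.
have qZ (r : R) x : q (r%:C *: x) = r * q x.
  have [r0|r0|->] := ltgtP r 0; last by rewrite rmorph0 scale0r mul0r.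
    rewrite -[r]opprK rmorphN scaleNr qN real_sublinearZ//; lra.
  by rewrite real_sublinearZ.
pose f x : R[i]^o := q x +i* - q ('i%C *: x).
have lf : linear f.
  move=> [a b] x y; rewrite /f; apply/eqP; rewrite eq_complex /=.
  have E1 : (a +i* b) = a%:C + b%:C * 'i%C :> R[i].
    by apply/eqP; rewrite eq_complex /=; apply/andP; split; apply/eqP; ring.
  have E2 : 'i%C * (a +i* b) = a%:C * 'i%C - b%:C :> R[i].
    by apply/eqP; rewrite eq_complex /=; apply/andP; split; apply/eqP; ring.
  rewrite scalerDr scalerA E2 E1 !scalerDl scaleNr -!scalerA !qD qN !qZ.
  by apply/andP; split; apply/eqP; ring.
exists (HB.pack_for {linear V -> R[i]^o} f
  (GRing.isLinear.Build R[i] V R[i]^o _ f lf)); split => //=.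
apply/eqP; rewrite eq_le qp/=.
have := le_trans (qd (- x0)) (directional_inf_le1 x0 sp (- x0)).
by rewrite addNr (real_sublinear0 sp) qN; lra.
Qed.

End HahnBanach.

Section LinearRetraction.
Context {K : fieldType} {V W : lmodType K}.

Definition subspace (X : set W) : Prop :=
  X 0 /\ forall (a : K) x y, X x -> X y -> X (a *: x + y).

Lemma injective_linear_retraction (f : {linear V -> W}) : injective f ->
  exists g : {linear W -> V}, cancel f g.
Proof.
move=> injf.
(* A maximal subspace X that meets the range of f in 0 is a complement of it.
   The condition "or X empty" makes the family stable under the empty chain. *)
pose P : set (set W) := [set X | X = set0 \/
  (subspace X /\ forall v, X (f v) -> v = 0)].
have [F FP Ftot|X [PX Xmax]] := @Zorn_bigcup W P.
  have [FN0|F0] := pselect (exists2 X, F X & X !=set0); last first.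
    left; apply/seteqP; split=> // x [X FX Xx]; case: F0.
    by exists X => //; exists x.
  right; have {FN0} [X0 FX0 [x0 X0x0]] := FN0.
  have Fs X x : F X -> X x -> subspace X /\ forall v, X (f v) -> v = 0.
    by move=> FX Xx; have [X00|//] := FP _ FX; move: Xx; rewrite X00.
  split; last by move=> v [X FX Xv]; exact: (Fs X _ FX Xv).2.
  split; first by exists X0 => //; exact: (Fs _ _ FX0 X0x0).1.1.
  move=> a x y [X FX Xx] [Y FY Yy].
  have [XY|YX] := Ftot _ _ FX FY.
    by exists Y => //; apply: (Fs _ _ FY Yy).1.2 => //; exact: XY.
  by exists X => //; apply: (Fs _ _ FX Xx).1.2 => //; exact: YX.
have {PX} [sX Xf] : subspace X /\ forall v, X (f v) -> v = 0.
  case: PX => // X0; exfalso; apply: (Xmax [set 0]).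
    split; first by rewrite X0.
    by move=> /(_ 0 erefl); rewrite X0.
  right; split; last by move=> v fv0; apply: injf; rewrite fv0 linear0.
  by split=> // a _ _ -> ->; rewrite scaler0 addr0.
have XN x : X x -> X (- x).
  by move=> Xx; rewrite -[- x]addr0 -scaleN1r; apply: sX.2 => //; exact: sX.1.
have XZ a x : X x -> X (a *: x).
  by move=> Xx; rewrite -[_ *: x]addr0; apply: sX.2 => //; exact: sX.1.
have XD x y : X x -> X y -> X (x + y).
  by move=> Xx Xy; rewrite -[x]scale1r; exact: sX.2.
(* Otherwise the span [Y] of [X] and [w] would be a strictly larger subspace that still meets the
   range of [f] in 0. *)
have dec w : exists v, X (w - f v).
  apply: contrapT => nw.
  pose Y : set W := [set z | exists x a, X x /\ z = x + a *: w].
  apply: (Xmax Y).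
    split=> [x Xx|YX]; first by exists x, 0; rewrite scale0r addr0.
    apply: nw; exists 0; rewrite linear0 subr0; apply: YX.
    by exists 0, 1; rewrite scale1r add0r; split=> //; exact: sX.1.
  right; split.
    split; first by exists 0, 0; rewrite scale0r addr0; split=> //; exact: sX.1.
    move=> a _ _ [x [b [Xx ->]]] [y [c [Xy ->]]].
    exists (a *: x + y), (a * b + c); split; first exact: sX.2.
    by rewrite scalerDr scalerA addrACA -scalerDl.
  move=> v [x [a [Xx fvE]]].
  have [a0|aN0] := eqVneq a 0.
    by apply: Xf; rewrite fvE a0 scale0r addr0.
  case: nw; exists (a^-1 *: v); rewrite linearZ /= fvE scalerDr scalerA.
  by rewrite mulVf// scale1r opprD addrCA subrr addr0; exact/XN/XZ.
have /choice[g gP] := dec.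
have guniq w v : X (w - f v) -> g w = v.
  move=> Xwv; apply/eqP; rewrite -subr_eq0; apply/eqP/Xf.
  have -> : f (g w - v) = (w - f v) - (w - f (g w)).
    by rewrite linearB opprB [RHS]addrC addrA subrK.
  by apply: XD => //; exact: XN.
have lg : linear g.
  move=> a x y; apply: guniq; rewrite linearP.
  have -> : a *: x + y - (a *: f (g x) + f (g y))
      = a *: (x - f (g x)) + (y - f (g y)).
    by rewrite scalerBr opprD addrACA.
  by apply: sX.2.
exists (HB.pack_for {linear W -> V} g (GRing.isLinear.Build K W V _ g lg)).
by move=> v /=; apply: guniq; rewrite subrr; exact: sX.1.
Qed.

End LinearRetraction.

(** * Matrices over an operator system *)

Lemma sum_mxtens (V : nmodType) m n (F : 'I_(m * n) -> V) :
  \sum_p F p = \sum_a \sum_b F (mxtens_index (a, b)).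
Proof.
rewrite pair_big /= (reindex (@mxtens_index m n)) /=.
  by apply: eq_bigr => -[].
by exists (@mxtens_unindex m n) => x _; rewrite (mxtens_indexK, mxtens_unindexK).
Qed.

Section Sandwich.
Context {R : realType} {V : lmodType R[i]}.

(* A X B^*, the sesquilinear form of mxcongr *)
Definition mxsandwich m n p q (A : 'M[R[i]]_(m, n)) (X : 'M[V]_(n, p))
    (B : 'M[R[i]]_(q, p)) : 'M[V]_(m, q) :=
  \matrix_(i, j) \sum_k \sum_l (A i k * Num.conj (B j l)) *: X k l.

Lemma mxcongrE m n (A : 'M[R[i]]_(m, n)) (X : 'M[V]_n) :
  mxcongr A X = mxsandwich A X A.
Proof. by []. Qed.

Lemma mxsandwichDl m n p q (A1 A2 : 'M[R[i]]_(m, n)) (X : 'M[V]_(n, p))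
    (B : 'M[R[i]]_(q, p)) :
  mxsandwich (A1 + A2) X B = mxsandwich A1 X B + mxsandwich A2 X B.
Proof.
apply/matrixP => i j; rewrite !mxE -big_split; apply: eq_bigr => k _.
by rewrite -big_split; apply: eq_bigr => l _; rewrite mxE mulrDl scalerDl.
Qed.

Lemma mxsandwichDr m n p q (A : 'M[R[i]]_(m, n)) (X : 'M[V]_(n, p))
    (B1 B2 : 'M[R[i]]_(q, p)) :
  mxsandwich A X (B1 + B2) = mxsandwich A X B1 + mxsandwich A X B2.
Proof.
apply/matrixP => i j; rewrite !mxE -big_split; apply: eq_bigr => k _.
rewrite -big_split; apply: eq_bigr => l _.
by rewrite mxE rmorphD mulrDr scalerDl.
Qed.

Lemma mxsandwich0 m n p q (A : 'M[R[i]]_(m, n)) (B : 'M[R[i]]_(q, p)) :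
  mxsandwich A (0 : 'M[V]_(n, p)) B = 0.
Proof.
apply/matrixP => i j; rewrite !mxE big1 // => k _.
by rewrite big1 // => l _; rewrite mxE scaler0.
Qed.

Lemma mxsandwich0l m n p q (X : 'M[V]_(n, p)) (B : 'M[R[i]]_(q, p)) :
  mxsandwich (0 : 'M_(m, n)) X B = 0.
Proof.
apply/matrixP => i j; rewrite !mxE big1 // => k _.
by rewrite big1 // => l _; rewrite mxE mul0r scale0r.
Qed.

Lemma mxsandwich0r m n p q (A : 'M[R[i]]_(m, n)) (X : 'M[V]_(n, p)) :
  mxsandwich A X (0 : 'M_(q, p)) = 0.
Proof.
apply/matrixP => i j; rewrite !mxE big1 // => k _.
by rewrite big1 // => l _; rewrite mxE rmorph0 mulr0 scale0r.
Qed.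

Lemma mxsandwichA m n p q r s (A : 'M[R[i]]_(m, n)) (B : 'M[R[i]]_(n, p))
    (X : 'M[V]_(p, q)) (C : 'M[R[i]]_(r, q)) (D : 'M[R[i]]_(s, r)) :
  mxsandwich A (mxsandwich B X C) D = mxsandwich (A *m B) X (D *m C).
Proof.
apply/matrixP => i j; rewrite !mxE.
transitivity (\sum_k \sum_l \sum_k' \sum_l'
    (A i k * Num.conj (D j l)) *: ((B k k' * Num.conj (C l l')) *: X k' l')).
  apply: eq_bigr => k _; apply: eq_bigr => l _; rewrite mxE scaler_sumr.
  by apply: eq_bigr => k' _; rewrite scaler_sumr.
under eq_bigr do rewrite exchange_big; rewrite exchange_big /=.
apply: eq_bigr => k' _.
transitivity (\sum_l' \sum_k \sum_l (A i k * Num.conj (D j l)) *: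
    ((B k k' * Num.conj (C l l')) *: X k' l')).
  by under eq_bigr do rewrite exchange_big; rewrite exchange_big.
apply: eq_bigr => l' _; rewrite !mxE rmorph_sum mulr_suml scaler_suml.
apply: eq_bigr => k _; rewrite mulr_sumr scaler_suml; apply: eq_bigr => l _.
by rewrite rmorphM scalerA; congr (_ *: _); ring.
Qed.

(** The outer factors are rows of the identity matrix. Hence a principal submatrix is a compression,
    and cones stable under congruence are stable under passing to it. *)
Lemma mxsub_sandwich m n p q (f : 'I_m -> 'I_n) (g : 'I_p -> 'I_q)
    (X : 'M[V]_(n, q)) :
  mxsub f g X = mxsandwich (rowsub f 1%:M) X (rowsub g 1%:M).
Proof.
apply/matrixP => i j; rewrite !mxE (bigD1 (f i)) //= [X in _ + X]big1 ?addr0.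
  rewrite (bigD1 (g j)) //= big1 ?addr0 => [|l lj].
    by rewrite !mxE !eqxx !mulr1n rmorph1 mulr1 scale1r.
  by rewrite !mxE [g j == l]eq_sym (negbTE lj) rmorph0 mulr0 scale0r.
move=> k ki; rewrite big1 // => l _.
by rewrite !mxE [f i == k]eq_sym (negbTE ki) mul0r scale0r.
Qed.

Lemma mxsandwich1 m n (X : 'M[V]_(m, n)) : mxsandwich 1%:M X 1%:M = X.
Proof.
have := @mxsub_sandwich m m n n id id X; by rewrite !mxsub_id => <-.
Qed.

Lemma mxsandwich_col m1 m2 n p q1 q2 (A1 : 'M[R[i]]_(m1, n))
    (A2 : 'M[R[i]]_(m2, n)) (X : 'M[V]_(n, p)) (B1 : 'M[R[i]]_(q1, p))
    (B2 : 'M[R[i]]_(q2, p)) :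
  mxsandwich (col_mx A1 A2) X (col_mx B1 B2) =
  block_mx (mxsandwich A1 X B1) (mxsandwich A1 X B2)
           (mxsandwich A2 X B1) (mxsandwich A2 X B2).
Proof.
apply/matrixP => i j.
case: (split_ordP i) => i' ->; case: (split_ordP j) => j' ->;
  rewrite !(block_mxEul, block_mxEur, block_mxEdl, block_mxEdr) !mxE;
  by apply: eq_bigr => k _; apply: eq_bigr => l _; rewrite !(col_mxEu, col_mxEd).
Qed.

Lemma mxcongr_scalar n (c : R[i]) (X : 'M[V]_n) :
  mxcongr c%:M X = map_mx ( *:%R (c * Num.conj c)) X.
Proof.
apply/matrixP => i j; rewrite !mxE (bigD1 i) //= [X in _ + X]big1 ?addr0.
  rewrite (bigD1 j) //= big1 ?addr0 => [|l lj].
    by rewrite !mxE !eqxx !mulr1n.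
  by rewrite !mxE [j == l]eq_sym (negbTE lj) rmorph0 mulr0 scale0r.
move=> k ki; rewrite big1 // => l _.
by rewrite !mxE [i == k]eq_sym (negbTE ki) mul0r scale0r.
Qed.

Definition entry_mx n (i j : 'I_n) (v : V) : 'M[V]_n :=
  \matrix_(k, l) (v *+ ((k == i) && (l == j))).

Lemma matrix_sum_entry n (X : 'M[V]_n) :
  X = \sum_i \sum_j entry_mx i j (X i j).
Proof.
apply/matrixP => k l; rewrite summxE (bigD1 k) //= [X in _ + X]big1 ?addr0.
  rewrite summxE (bigD1 l) //= big1 ?addr0 ?mxE ?eqxx // => j jl.
  by rewrite mxE [l == j]eq_sym (negbTE jl) andbF.
move=> i ik; rewrite summxE big1 // => j _.
by rewrite mxE [k == i]eq_sym (negbTE ik).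
Qed.

Lemma entry_mx_sum n (i j : 'I_n) (I : Type) (r : seq I) (F : I -> V) :
  entry_mx i j (\sum_(k <- r) F k) = \sum_(k <- r) entry_mx i j (F k).
Proof.
apply/matrixP => k l; rewrite summxE mxE -sumrMnl.
by apply: eq_bigr => m _; rewrite mxE.
Qed.

End Sandwich.

Lemma map_mxsandwich (R : realType) (V W : lmodType R[i]) (f : {linear V -> W})
    m n p q (A : 'M[R[i]]_(m, n)) (X : 'M[V]_(n, p)) (B : 'M[R[i]]_(q, p)) :
  map_mx f (mxsandwich A X B) = mxsandwich A (map_mx f X) B.
Proof.
apply/matrixP => i j; rewrite !mxE linear_sum; apply: eq_bigr => k _.
by rewrite linear_sum; apply: eq_bigr => l _; rewrite linearZ mxE.
Qed.

Section OperatorSystemTheory.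
Context {R : realType} {S : operatorSystemType R}.

Lemma starD (x y : S) : star (x + y) = star x + star y.
Proof.
by have := star_antilinear 1 x y; rewrite scale1r rmorph1 scale1r.
Qed.

Lemma star0 : star (0 : S) = 0.
Proof. by apply: (addrI (star 0)); rewrite -starD !addr0. Qed.

Lemma starZ (a : R[i]) (x : S) : star (a *: x) = Num.conj a *: star x.
Proof. by have := star_antilinear a x 0; rewrite !addr0 star0 addr0. Qed.

Lemma starN (x : S) : star (- x) = - star x.
Proof. by rewrite -scaleN1r starZ rmorphN1 scaleN1r. Qed.

Lemma mpos_scale n (r : R) (X : 'M[S]_n) : 0 <= r -> mpos n X ->
  mpos n (map_mx ( *:%R r%:C) X).
Proof.
move=> r0 pX; have := mpos_congr _ _ ((Num.sqrt r)%:C%:M : 'M_n) _ pX.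
rewrite mxcongr_scalar [Num.conj _]conjc_real -rmorphM /=.
by rewrite -expr2 sqr_sqrtr.
Qed.

Lemma mpos0 n : mpos n (0 : 'M[S]_n).
Proof.
have H0 : map_mx star (0 : 'M[S]_n)^T = 0.
  by apply/matrixP => i j; rewrite !mxE star0.
(* The order unit provides some positive matrix, and scaling it by 0 gives 0. *)
have [r _ /(mpos_scale (lexx 0))] := ounit_order n _ H0.
by congr (mpos n _); apply/matrixP => i j; rewrite !mxE scale0r.
Qed.

Lemma mpos_block n1 n2 (P1 : 'M[S]_n1) (P2 : 'M[S]_n2) :
  mpos n1 P1 -> mpos n2 P2 -> mpos (n1 + n2) (block_mx P1 0 0 P2).
Proof.
move=> /(mpos_congr _ _ (col_mx 1%:M (0 : 'M_(n2, n1)))) p1.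
move=> /(mpos_congr _ _ (col_mx (0 : 'M_(n1, n2)) 1%:M)) p2.
have := mposD _ _ _ p1 p2; congr mpos; rewrite !mxcongrE !mxsandwich_col.
rewrite !mxsandwich1 !(mxsandwich0l, mxsandwich0r) add_block_mx.
by rewrite !addr0 !add0r.
Qed.

(** The matrix in the definition of [onorm]; for [r >= 0] its positivity expresses that [s] has norm
    at most [r]. *)
Definition oblock (r : R) (s : S) : 'M[S]_(1 + 1) :=
  block_mx (const_mx (r%:C *: ounit)) (const_mx s)
           (const_mx (star s)) (const_mx (r%:C *: ounit)).

Lemma oblock_mpos (s : S) : exists2 r : R, 0 < r & mpos (1 + 1) (oblock r s).
Proof.
pose X : 'M[S]_(1 + 1) :=
  block_mx (const_mx 0) (const_mx s) (const_mx (star s)) (const_mx 0).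
have XH : map_mx star X^T = X.
  by rewrite /X tr_block_mx map_block_mx !trmx_const !map_const_mx star0 starK.
have [r r0 pr] := ounit_order (1 + 1) X XH.
exists r => //; move: pr; congr mpos; rewrite /X /oblock.
apply/matrixP => i j; rewrite mxE [diag_unit _ _ i j]mxE.
case: (split_ordP i) => i' ->; case: (split_ordP j) => j' ->;
  rewrite !(block_mxEul, block_mxEur, block_mxEdl, block_mxEdr) !mxE
    ?eq_lshift ?eq_rshift ?eq_lrshift ?eq_rlshift.
- by rewrite (ord1 i') (ord1 j') eqxx mulr1n addr0.
- by rewrite mulr0n add0r.
- by rewrite mulr0n add0r.
- by rewrite (ord1 i') (ord1 j') eqxx mulr1n addr0.
Qed.

(** After division by [C] this is the universal property of an infimum. For [C = 0] one admissible
    [r], supplied by [oblock_mpos], gives [x <= 0]. *)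
Lemma onorm_le_bound (C : R) (s : S) (x : R) : 0 <= C ->
  (forall r, 0 <= r -> mpos (1 + 1) (oblock r s) -> x <= C * r) ->
  x <= C * onorm s.
Proof.
rewrite le_eqVlt => /predU1P[<-|C0] h.
  by have [r r0 /(h r (ltW r0))] := oblock_mpos s; rewrite !mul0r.
rewrite -ler_pdivrMl//; apply: lb_le_inf.
  by have [r r0 pr] := oblock_mpos s; exists r; split=> //; exact: ltW.
by move=> r [r0 pr]; rewrite ler_pdivrMl//; exact: h.
Qed.

End OperatorSystemTheory.

(** A hermitian element plus a large multiple of the unit is positive, so its image is hermitian,
    and the multiple cancels because [f] is unital. A general [x] is reduced to the hermitian
    elements [a = x + star x] and [b = i (x - star x)], with [2 x = a - i b]. *)
Lemma cp_star (R : realType) (S T : operatorSystemType R) (f : {linear S -> T}) :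
  completely_positive mpos mpos f -> f ounit = ounit ->
  forall x, f (star x) = star (f x).
Proof.
move=> cpf f1 x.
have hf y : star y = y -> star (f y) = f y.
  move=> yH; have YH : map_mx star (const_mx y : 'M[S]_1)^T = const_mx y.
    by rewrite trmx_const map_const_mx yH.
  have [r _ /cpf/mpos_herm/matrixP/(_ ord0 ord0)] := ounit_order 1 _ YH.
  rewrite !mxE eqxx mulr1n linearD linearZ /= f1 starD starZ ounit_herm.
  by rewrite [Num.conj _]conjc_real => /addrI.
pose a := x + star x; pose b := 'i%C *: (x - star x).
have aH : star a = a by rewrite /a starD starK addrC.
have conji : Num.conj ('i%C : R[i]) = - 'i%C :> R[i].
  by apply/eqP; rewrite eq_complex /= oppr0 eqxx /=.
have bH : star b = b.
  by rewrite /b starZ starD starN starK conji scaleNr -scalerN opprB addrC.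
have ii : 'i%C * 'i%C = -1 :> R[i] by rewrite -expr2 sqr_i.
have xE : 2 *: x = a - 'i%C *: b.
  by rewrite /a /b scalerA ii scaleN1r opprK addrACA subrr addr0
     scaler_nat mulr2n.
have x'E : 2 *: star x = a + 'i%C *: b.
  by rewrite /a /b scalerA ii scaleN1r opprB [x + _]addrC addrACA subrr addr0
     scaler_nat mulr2n.
have two : (2 : R[i]) != 0 by rewrite pnatr_eq0.
clearbody a b; apply: (scalerI two); rewrite -linearZ x'E linearD /= linearZ /=.
have -> : 2 *: star (f x) = star (f (2 *: x)).
  by rewrite linearZ starZ /= conjC_nat.
by rewrite xE [f (a - _)]linearB linearZ /= starD starN starZ conji !hf//
  scaleNr opprK.
Qed.

(** * The maximal tensor product *)

Section TensorTheory.
Context {R : realType} {S T : lmodType R[i]}.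

Definition tensor_eval (b : bilinear_form S T) (u : tensor S T) : R[i]^o := u b.

Fact tensor_eval_linear (b : bilinear_form S T) : linear (tensor_eval b).
Proof. by []. Qed.

HB.instance Definition _ (b : bilinear_form S T) :=
  GRing.isLinear.Build R[i] (tensor S T) R[i]^o _ (tensor_eval b)
    (tensor_eval_linear b).

Lemma tensor_fun_sum (I : Type) (r : seq I) (F : I -> tensor S T)
    (b : bilinear_form S T) :
  (\sum_(i <- r) F i) b = \sum_(i <- r) (F i b : R[i]).
Proof. exact: (linear_sum (tensor_eval b)). Qed.

Lemma tensor_sumE (u : tensor S T) :
  exists p : seq (S * T), u = \sum_(xy <- p) elementary xy.1 xy.2.
Proof.
have /asboolP[p uE] := tensor_funP u; exists p; apply: val_inj => /=.
rewrite uE; apply/funext => b.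
by rewrite tensor_fun_sum.
Qed.

Fact elementary_bilinear : bilinear_for *:%R *:%R (@elementary R S T).
Proof.
split=> [y|x] a u v; apply: val_inj; apply/funext => b /=.
  by rewrite linearPl.
by rewrite linearPr.
Qed.

HB.instance Definition _ := bilinear_isBilinear.Build R[i] S T (tensor S T)
  *:%R *:%R (@elementary R S T) elementary_bilinear.

End TensorTheory.

(** A linear left inverse [g] of [f], of which no positivity is asked, induces the left inverse
    [tensor_map g idfun]. *)
Lemma tensor_map_inj (R : realType) (S S' T : lmodType R[i])
    (f : {linear S -> S'}) :
  injective f -> injective (tensor_map f (@idfun T)).
Proof.
move=> /injective_linear_retraction[g fK].
apply: (can_inj (g := tensor_map g (@idfun T))) => u.
have [p ->] := tensor_sumE u; rewrite !linear_sum; apply: eq_bigr => xy _ /=.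
by rewrite !tensor_map_elementary /= fK.
Qed.

Section TensorStar.
Context {R : realType} {S T : operatorSystemType R}.

(** Tensors are functionals on bilinear forms, so the involution on them is defined by duality from
    an involution on forms; independence of the representation as a sum of elementary tensors is
    then automatic. *)
Definition conj_form (b : bilinear_form S T) (x : S) (y : T) : R[i]^o :=
  Num.conj (b (star x) (star y)).

Fact conj_form_bilinear b : bilinear_for *:%R *:%R (conj_form b).
Proof.
split=> [y|x] a u v; rewrite /conj_form star_antilinear ?linearPl ?linearPr.
  by rewrite rmorphD rmorphM /= conjCK.
by rewrite rmorphD rmorphM /= conjCK.
Qed.

HB.instance Definition _ b := bilinear_isBilinear.Build R[i] S T R[i]^o
  *:%R *:%R (conj_form b) (conj_form_bilinear b).

Fact tensor_star_subproof (u : tensor S T) :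
  (fun b : bilinear_form S T => Num.conj (u (conj_form b))) \in @tensor_span R S T.
Proof.
case: u => u /= /asboolP[p ->]; apply/asboolP.
exists [seq (star xy.1, star xy.2) | xy <- p]; apply/funext => b.
rewrite big_map rmorph_sum; apply: eq_bigr => xy _ /=.
by rewrite /conj_form conjCK.
Qed.

Definition tensor_star (u : tensor S T) : tensor S T :=
  Tensor (tensor_star_subproof u).

Lemma tensor_star_elementary x y :
  tensor_star (elementary x y) = elementary (star x) (star y).
Proof.
by apply: val_inj; apply/funext => b /=; rewrite /conj_form conjCK.
Qed.

Lemma tensor_star_antilinear (a : R[i]) (u v : tensor S T) :
  tensor_star (a *: u + v) = Num.conj a *: tensor_star u + tensor_star v.
Proof.
apply: val_inj; apply/funext => b /=.
by rewrite !fctE -![_ *: _]/(_ * _ : R[i]) rmorphD rmorphM.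
Qed.

Lemma tensor_starD (u v : tensor S T) :
  tensor_star (u + v) = tensor_star u + tensor_star v.
Proof.
by have := tensor_star_antilinear 1 u v; rewrite rmorph1 !scale1r.
Qed.

Lemma tensor_star0 : tensor_star (0 : tensor S T) = 0.
Proof. by apply: (addrI (tensor_star 0)); rewrite -tensor_starD !addr0. Qed.

Lemma tensor_starZ (a : R[i]) (u : tensor S T) :
  tensor_star (a *: u) = Num.conj a *: tensor_star u.
Proof.
by have := tensor_star_antilinear a u 0; rewrite tensor_star0 !addr0.
Qed.

Lemma tensor_starN (u : tensor S T) : tensor_star (- u) = - tensor_star u.
Proof. by rewrite -scaleN1r tensor_starZ rmorphN1 scaleN1r. Qed.

Lemma tensor_star_sum (I : Type) (r : seq I) (F : I -> tensor S T) :
  tensor_star (\sum_(i <- r) F i) = \sum_(i <- r) tensor_star (F i).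
Proof. exact: (big_morph _ tensor_starD tensor_star0). Qed.

Definition tensor_adj n (U : 'M[tensor S T]_n) : 'M[tensor S T]_n :=
  map_mx tensor_star U^T.

Lemma tensor_adjD n (U W : 'M[tensor S T]_n) :
  tensor_adj (U + W) = tensor_adj U + tensor_adj W.
Proof. by apply/matrixP => i j; rewrite !mxE tensor_starD. Qed.

Lemma tensor_adj_entry n (i j : 'I_n) (u : tensor S T) :
  tensor_adj (entry_mx i j u) = entry_mx j i (tensor_star u).
Proof.
apply/matrixP => k l; rewrite !mxE andbC.
by case: (_ && _) => //; rewrite ?mulr0n ?tensor_star0.
Qed.

Lemma tensor_adj_congr m n (A : 'M[R[i]]_(m, n)) (U : 'M[tensor S T]_n) :
  tensor_adj (mxcongr A U) = mxcongr A (tensor_adj U).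
Proof.
apply/matrixP => i j; rewrite !mxE tensor_star_sum [RHS]exchange_big.
apply: eq_bigr => k _; rewrite tensor_star_sum; apply: eq_bigr => l _.
by rewrite tensor_starZ !mxE rmorphM /= conjCK mulrC.
Qed.

Lemma tensor_adj_elementary k m (P : 'M[S]_k) (Q : 'M[T]_m) :
  map_mx star P^T = P -> map_mx star Q^T = Q ->
  tensor_adj (mx_elementary P Q) = mx_elementary P Q.
Proof.
move=> hP hQ; apply/matrixP => p q; rewrite !mxE tensor_star_elementary.
by rewrite -{1}hP -{1}hQ !mxE !starK.
Qed.

End TensorStar.

Lemma tensor_map_star (R : realType) (S E T : operatorSystemType R)
    (f : {linear S -> E}) (u : tensor S T) :
  (forall x, f (star x) = star (f x)) ->
  tensor_star (tensor_map f (@idfun T) u) =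
  tensor_map f (@idfun T) (tensor_star u).
Proof.
move=> fstar; have [p ->] := tensor_sumE u.
rewrite tensor_star_sum !linear_sum tensor_star_sum; apply: eq_bigr => xy _ /=.
by rewrite tensor_star_elementary !tensor_map_elementary tensor_star_elementary
  fstar.
Qed.

Section TensorCone.
Context {R : realType} {S T : operatorSystemType R}.
Local Notation e := (elementary (ounit : S) (ounit : T)).

(* The cone whose Archimedean closure is max_mpos. *)
Definition tensor_cone n (U : 'M[tensor S T]_n) : Prop :=
  exists k m (P : 'M[S]_k) (Q : 'M[T]_m) (A : 'M[R[i]]_(n, k * m)),
    [/\ mpos k P, mpos m Q & U = mxcongr A (mx_elementary P Q)].

Lemma tensor_cone_herm n (U : 'M[tensor S T]_n) :
  tensor_cone U -> tensor_adj U = U.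
Proof.
move=> [k [m [P [Q [A [/mpos_herm hP /mpos_herm hQ ->]]]]]].
by rewrite tensor_adj_congr tensor_adj_elementary.
Qed.

Lemma tensor_cone_congr m n (A : 'M[R[i]]_(m, n)) (U : 'M[tensor S T]_n) :
  tensor_cone U -> tensor_cone (mxcongr A U).
Proof.
move=> [k [l [P [Q [B [pP pQ ->]]]]]]; exists k, l, P, Q, (A *m B).
by split=> //; rewrite !mxcongrE mxsandwichA.
Qed.

Lemma tensor_cone_mxsub k m n (P : 'M[S]_k) (Q : 'M[T]_m)
    (f : 'I_n -> 'I_(k * m)) :
  mpos k P -> mpos m Q -> tensor_cone (mxsub f f (mx_elementary P Q)).
Proof.
move=> pP pQ; exists k, m, P, Q, (rowsub f 1%:M); split=> //.
exact: mxsub_sandwich.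
Qed.

(** For block diagonal [P] and [Q], the matrix [mx_elementary P Q] contains those of [P1], [Q1] and
    of [P2], [Q2] as principal submatrices on disjoint index sets, with zero cross blocks. Extending
    [A1] and [A2] by zero and adding them compresses it to the sum. *)
Lemma tensor_coneD n (U W : 'M[tensor S T]_n) :
  tensor_cone U -> tensor_cone W -> tensor_cone (U + W).
Proof.
move=> [k1 [m1 [P1 [Q1 [A1 [pP1 pQ1 ->]]]]]].
move=> [k2 [m2 [P2 [Q2 [A2 [pP2 pQ2 ->]]]]]].
pose P := block_mx P1 0 0 P2; pose Q := block_mx Q1 0 0 Q2.
pose f1 (p : 'I_(k1 * m1)) : 'I_((k1 + k2) * (m1 + m2)) :=
  mxtens_index (lshift k2 (mxtens_unindex p).1, lshift m2 (mxtens_unindex p).2).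
pose f2 (p : 'I_(k2 * m2)) : 'I_((k1 + k2) * (m1 + m2)) :=
  mxtens_index (rshift k1 (mxtens_unindex p).1, rshift m1 (mxtens_unindex p).2).
have s11 : mxsub f1 f1 (mx_elementary P Q) = mx_elementary P1 Q1.
  apply/matrixP => p q; rewrite mxE [LHS]mxE [RHS]mxE !mxtens_indexK /=.
  by rewrite !block_mxEul.
have s22 : mxsub f2 f2 (mx_elementary P Q) = mx_elementary P2 Q2.
  apply/matrixP => p q; rewrite mxE [LHS]mxE [RHS]mxE !mxtens_indexK /=.
  by rewrite !block_mxEdr.
have s12 : mxsub f1 f2 (mx_elementary P Q) = 0.
  apply/matrixP => p q; rewrite mxE [LHS]mxE !mxtens_indexK /= !block_mxEur.
  by rewrite !mxE linear0l.
have s21 : mxsub f2 f1 (mx_elementary P Q) = 0.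
  apply/matrixP => p q; rewrite mxE [LHS]mxE !mxtens_indexK /= !block_mxEdl.
  by rewrite !mxE linear0l.
exists (k1 + k2)%N, (m1 + m2)%N, P, Q.
exists (A1 *m rowsub f1 1%:M + A2 *m rowsub f2 1%:M).
split; [exact: mpos_block|exact: mpos_block|].
rewrite !mxcongrE mxsandwichDl !mxsandwichDr -!mxsandwichA -!mxsub_sandwich.
by rewrite s11 s12 s21 s22 !mxsandwich0 addr0 add0r.
Qed.

Lemma tensor_cone0 n : tensor_cone (0 : 'M[tensor S T]_n).
Proof.
exists 0, 0, 0, 0, 0; split; [exact: mpos0|exact: mpos0|].
by rewrite mxcongrE mxsandwich0l.
Qed.

Lemma tensor_coneZ n (r : R) (U : 'M[tensor S T]_n) : 0 <= r ->
  tensor_cone U -> tensor_cone (map_mx ( *:%R r%:C) U).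
Proof.
move=> r0 /(tensor_cone_congr (Num.sqrt r)%:C%:M); rewrite mxcongr_scalar.
by rewrite [Num.conj _]conjc_real -rmorphM /= -expr2 sqr_sqrtr.
Qed.

Lemma tensor_cone_sum n (I : Type) (r : seq I) (F : I -> 'M[tensor S T]_n) :
  (forall i, tensor_cone (F i)) -> tensor_cone (\sum_(i <- r) F i).
Proof.
move=> h; elim/big_ind: _ => //; [exact: tensor_cone0|exact: tensor_coneD].
Qed.

(* The Schur product of the positive matrices (r1, x; x^*, r1) and
   (s1, y; y^*, s1), compressed by the two columns c e_i and e_j. *)
Lemma tensor_cone_oblock n (i j : 'I_n) (c : R[i]) (r s : R) (x : S) (y : T) :
  mpos (1 + 1) (oblock r x) -> mpos (1 + 1) (oblock s y) ->
  tensor_cone (entry_mx i i ((c * Num.conj c * (r * s)%:C) *: e)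
    + entry_mx i j (c *: elementary x y)
    + entry_mx j i (Num.conj c *: elementary (star x) (star y))
    + entry_mx j j ((r * s)%:C *: e)).
Proof.
move=> pr ps; pose B : 'M[R[i]]_(n, 1 + 1) :=
  row_mx (\col_k (c *+ (k == i))) (\col_k (k == j)%:R).
have unitE : elementary (r%:C *: (ounit : S)) (s%:C *: (ounit : T))
    = (r * s)%:C *: e.
  by rewrite linearZl_LR linearZr_LR /= scalerA -rmorphM.
(* The indices [(a, a)] cut the Schur product out of the Kronecker product. *)
have := tensor_cone_mxsub (fun a => mxtens_index (a, a)) pr ps.
set G := mxsub _ _ _ => /(tensor_cone_congr B).
have Gul : G (lshift 1 0) (lshift 1 0) = (r * s)%:C *: e.
  by rewrite mxE [LHS]mxE !mxtens_indexK /= !block_mxEul !mxE unitE.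
have Gur : G (lshift 1 0) (rshift 1 0) = elementary x y.
  by rewrite mxE [LHS]mxE !mxtens_indexK /= !block_mxEur !mxE.
have Gdl : G (rshift 1 0) (lshift 1 0) = elementary (star x) (star y).
  by rewrite mxE [LHS]mxE !mxtens_indexK /= !block_mxEdl !mxE.
have Gdr : G (rshift 1 0) (rshift 1 0) = (r * s)%:C *: e.
  by rewrite mxE [LHS]mxE !mxtens_indexK /= !block_mxEdr !mxE unitE.
congr tensor_cone; apply/matrixP => k l; rewrite [LHS]mxE.
rewrite big_split_ord !big_ord1 /= !big_split_ord !big_ord1 /=.
rewrite Gul Gur Gdl Gdr !(row_mxEl, row_mxEr) !mxE.
rewrite !addrA.
case: (k == i); case: (l == i); case: (k == j); case: (l == j);
  rewrite ?andbT ?andbF /=;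
rewrite ?(mulr0n, mulr1n, rmorph0, rmorph1, mulr0, mul0r, mulr1, mul1r, scale0r,
  scale1r, addr0, add0r, scalerA) //.
Qed.

End TensorCone.

Section TensorOrderUnit.
Context {R : realType} {S T : operatorSystemType R}.
Local Notation e := (elementary (ounit : S) (ounit : T)).

Lemma tensor_cone_entry n (i : 'I_n) (r : R) : 0 <= r ->
  tensor_cone (entry_mx i i (r%:C *: e)).
Proof.
move=> r0.
have [s s0 ps] := oblock_mpos (0 : S); have [t t0 pt] := oblock_mpos (0 : T).
have st0 : 0 < s * t by rewrite mulr_gt0.
(* With [c = 0] only the last of the four terms survives, [s * t] times the unit at position
   [(i, i)]; it is rescaled by [r / (s * t)]. *)
have /(tensor_coneZ (divr_ge0 r0 (ltW st0))) := tensor_cone_oblock i i 0 ps pt.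
congr tensor_cone; apply/matrixP => k l.
rewrite !mxE !mul0r rmorph0 !scale0r !mul0rn !add0r.
case: (_ && _); rewrite ?mulr0n ?scaler0// !mulr1n scalerA -rmorphM.
by rewrite -mulrA mulVf ?mulr1 ?gt_eqF.
Qed.

Lemma tensor_cone_diag n (d : 'I_n -> R) : (forall k, 0 <= d k) ->
  tensor_cone (\matrix_(k, l) (((d k)%:C *: e) *+ (k == l))).
Proof.
move=> d0; rewrite [X in tensor_cone X]matrix_sum_entry.
apply: tensor_cone_sum => i; apply: tensor_cone_sum => j.
rewrite mxE; have [<-|_] := eqVneq i j; first exact: tensor_cone_entry.
by rewrite mulr0n -(scale0r e) -[0]/(0%:C); move: (@tensor_cone0 R S T n);
  congr tensor_cone; apply/matrixP => k l; rewrite !mxE scale0r mul0rn.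
Qed.

Lemma tensor_cone_unit n (r : R) : 0 <= r ->
  tensor_cone (diag_unit (r%:C *: e) n).
Proof. by move=> r0; apply: (tensor_cone_diag (d := fun=> r)). Qed.

Lemma diag_unitD (V : lmodType R[i]) n (u v : V) :
  diag_unit (u + v) n = diag_unit u n + diag_unit v n.
Proof. by apply/matrixP => i j; rewrite !mxE mulrnDl. Qed.

(** Both sides are additive in [U], so it suffices to treat one elementary tensor in one entry.
    There [tensor_cone_oblock] with [c = 1] yields [U + tensor_adj U] together with unit terms at
    [(i, i)] and [(j, j)]. *)
Lemma tensor_order_unit n (U : 'M[tensor S T]_n) :
  exists r : R, tensor_cone (diag_unit (r%:C *: e) n + (U + tensor_adj U)).
Proof.
pose D (U : 'M[tensor S T]_n) :=
  exists r : R, tensor_cone (diag_unit (r%:C *: e) n + (U + tensor_adj U)).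
have D0 : D 0.
  exists 0; rewrite add0r; move: (@tensor_cone0 R S T n); congr tensor_cone.
  apply/matrixP => i j; rewrite !mxE rmorph0 scale0r mul0rn add0r.
  by rewrite tensor_star0.
have DD U1 U2 : D U1 -> D U2 -> D (U1 + U2).
  move=> [r1 c1] [r2 c2]; exists (r1 + r2); have := tensor_coneD c1 c2.
  congr tensor_cone; rewrite addrACA tensor_adjD [U1 + _ + _]addrACA.
  by rewrite rmorphD scalerDl diag_unitD.
suff De i j (x : S) (y : T) : D (entry_mx i j (elementary x y)).
  rewrite -/(D U) [U]matrix_sum_entry.
  elim/big_ind: _ => // i _; elim/big_ind: _ => // j _.
  have [p ->] := tensor_sumE (U i j).
  by rewrite entry_mx_sum; elim/big_ind: _ => //.
have [r r0 pr] := oblock_mpos x; have [s s0 ps] := oblock_mpos y.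
have d0 : 0 <= r * s by rewrite mulr_ge0// ltW.
(* The Schur product contributes [r * s] at [(i, i)] and again at [(j, j)]; [d] completes the
   diagonal to the constant [2 * (r * s)], also when [i = j]. *)
pose d k : R := r * s * (~~ (k == i))%:R + r * s * (~~ (k == j))%:R.
have dk k : 0 <= d k by rewrite addr_ge0// mulr_ge0.
exists (2 * (r * s)).
have := tensor_coneD (tensor_cone_diag dk) (tensor_cone_oblock i j 1 pr ps).
congr tensor_cone; apply/matrixP => k l; rewrite tensor_adj_entry !mxE.
rewrite rmorph1 !mul1r !scale1r tensor_star_elementary.
have -> : (r * s)%:C *: e *+ ((k == i) && (l == i)) =
    ((r * s * (k == i)%:R)%:C *: e) *+ (k == l).
  have [->|_] := eqVneq k i; rewrite /= ?mulr0 ?rmorph0 ?scale0r ?mul0rn//.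
  by rewrite mulr1 [i == l]eq_sym.
have -> : (r * s)%:C *: e *+ ((k == j) && (l == j)) =
    ((r * s * (k == j)%:R)%:C *: e) *+ (k == l).
  have [->|_] := eqVneq k j; rewrite /= ?mulr0 ?rmorph0 ?scale0r ?mul0rn//.
  by rewrite mulr1 [j == l]eq_sym.
rewrite !addrA addrAC; congr (_ + _); rewrite addrAC; congr (_ + _).
rewrite addrAC -!mulrnDl -!scalerDl -!rmorphD /d; congr (_%:C *: _ *+ _).
by case: (k == i); case: (k == j); rewrite /=; ring.
Qed.

(** For hermitian [U] the matrix [U + tensor_adj U] of the order bounds is [U + U]. Halving it
    halves the coefficient of the unit, which may then be increased to [r]. *)
Lemma tensor_cone_half n (t r : R) (U : 'M[tensor S T]_n) : t / 2 <= r ->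
  tensor_cone (diag_unit (t%:C *: e) n + (U + U)) ->
  tensor_cone (diag_unit (r%:C *: e) n + U).
Proof.
rewrite -subr_ge0 => tr ct; have h2 : 0 <= 2^-1 :> R by rewrite invr_ge0.
have := tensor_coneD (tensor_cone_unit n tr) (tensor_coneZ h2 ct).
congr tensor_cone; apply/matrixP => i j; rewrite !mxE.
rewrite scalerDr -scalerMnr scalerA -rmorphM -mulr2n -[U i j *+ 2]scaler_nat.
rewrite scalerA addrA -mulrnDl -scalerDl -rmorphD.
have -> : r - t / 2 + 2^-1 * t = r by ring.
by rewrite -(rmorph_nat (real_complex R)) -rmorphM mulVf ?scale1r// pnatr_eq0.
Qed.

End TensorOrderUnit.

(** * Separation of a hermitian matrix from the maximal cone *)

Section Separation.
Context {R : realType} {S T : operatorSystemType R}.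
Local Notation e := (elementary (ounit : S) (ounit : T)).

Definition matrix_pairing (E F : lmodType R[i]) n
    (beta : 'I_n -> 'I_n -> bilinear_form E F) (U : 'M[tensor E F]_n) : R[i] :=
  \sum_i \sum_j U i j (beta i j).

Section HermitianOutsideMax.
Variables (n : nat) (U0 : 'M[tensor S T]_n) (r0 : R).
Hypotheses (r0_gt0 : 0 < r0) (U0_herm : tensor_adj U0 = U0)
  (U0_out : ~ tensor_cone (diag_unit (r0%:C *: e) n + U0)).

Local Notation V := ('I_n -> 'I_n -> tensor S T).
Local Notation mat := (fun f : V => \matrix_(i, j) f i j : 'M[tensor S T]_n).

(* Twice the hermitian part occurs, to avoid a division by 2. *)
Definition order_bounds (f : V) : set R :=
  [set r | tensor_cone (diag_unit (r%:C *: e) n - (mat f + tensor_adj (mat f)))].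

(** A negative multiple of the unit in the cone could be added to an order bound of [U0] until [U0]
    plus [r0] times the unit lay in the cone, against [U0_out]. *)
Lemma tensor_unit_proper (r : R) :
  tensor_cone (diag_unit (r%:C *: e) n) -> 0 <= r.
Proof.
move=> cr; rewrite leNgt; apply/negP => rn0; apply: U0_out.
have [t ct] := tensor_order_unit U0.
rewrite U0_herm in ct.
have [tr|rt] := leP (t / 2) r0; first exact: tensor_cone_half ct.
(* This factor [q] solves [t + q * r = 2 * r0]. *)
have q0 : 0 <= (t - 2 * r0) / - r by apply: divr_ge0; lra.
apply: (tensor_cone_half (t := 2 * r0)); first lra.
have := tensor_coneD (tensor_coneZ q0 cr) ct.
congr tensor_cone; apply/matrixP => i j; rewrite !mxE addrA; congr (_ + _).
rewrite -scalerMnr scalerA -rmorphM -mulrnDl -scalerDl -rmorphD.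
by congr (_%:C *: _ *+ _); field; lra.
Qed.

Lemma order_boundsD f g a b : order_bounds f a -> order_bounds g b ->
  order_bounds (f + g) (a + b).
Proof.
move=> fa gb; have := tensor_coneD fa gb; congr tensor_cone.
apply/matrixP => i j; rewrite !mxE !fctE tensor_starD rmorphD scalerDl mulrnDl.
by rewrite addrACA; congr (_ + _); rewrite -opprD addrACA.
Qed.

Lemma order_boundsZ f (a r : R) : 0 <= r -> order_bounds f a ->
  order_bounds (r%:C *: f) (r * a).
Proof.
move=> rge0 /(tensor_coneZ rge0); congr tensor_cone.
apply/matrixP => i j; rewrite !mxE !fctE tensor_starZ [Num.conj _]conjc_real.
by rewrite scalerBr -scalerMnr scalerA -rmorphM scalerDr.
Qed.

(** The hermitian part of a skew-hermitian matrix is 0. Hence a functional whose real part lies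
    below [order_sup] has real part at most 0 there, which makes its values on the cone real. *)
Lemma order_bounds0 f : tensor_adj (mat f) = - mat f -> order_bounds f 0.
Proof.
move=> fE; rewrite /order_bounds/= fE subrr subr0.
exact: tensor_cone_unit.
Qed.

Lemma order_bounds_has_inf f : has_inf (order_bounds f).
Proof.
have nonempty g : exists r, order_bounds g r.
  have [r cr] := tensor_order_unit (mat (- g)); exists r.
  move: cr; congr tensor_cone; apply/matrixP => i j; rewrite !mxE !fctE.
  by rewrite tensor_starN opprD.
split; first exact: nonempty.
(* Bounds [a] of [f] and [b] of [- f] add up to a bound of 0, so [a + b >= 0] by
   [tensor_unit_proper]. *)
have [b gb] := nonempty (- f); exists (- b) => a fa.
have := order_boundsD fa gb; rewrite subrr => h.
suff /tensor_unit_proper : tensor_cone (diag_unit ((a + b)%:C *: e) n) by lra.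
move: h; congr tensor_cone; apply/matrixP => i j; rewrite !mxE.
by rewrite tensor_star0 addr0 subr0.
Qed.

Definition order_sup f : R := inf (order_bounds f).

Lemma order_sup_le f a : order_bounds f a -> order_sup f <= a.
Proof. by move=> fa; apply: ge_inf => //; exact: (order_bounds_has_inf f).2. Qed.

Lemma order_sup_sublinear : real_sublinear order_sup.
Proof.
apply: inf_sublinear => [f|f g a b fa gb|r f a r_gt0 fa].
- exact: order_bounds_has_inf.
- by exists (a + b) => //; exact: order_boundsD.
- by exists (r * a) => //; apply: order_boundsZ => //; exact: ltW.
Qed.

(** The functional [phi] is obtained by Hahn-Banach below [order_sup], with equality at [- U0]. A
    matrix in the cone has a negative with order bound 0, so [phi] has nonnegative real part on the
    cone, while [U0_out] gives [order_sup (- U0) >= 2 * r0 > 0]. *)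
Lemma hermitian_separation :
  exists beta : 'I_n -> 'I_n -> bilinear_form S T,
    (forall U, tensor_cone U -> 0 <= matrix_pairing beta U) /\
    ~ 0 <= matrix_pairing beta U0.
Proof.
pose f0 : V := fun i j => U0 i j.
have [phi [phi_le phiE]] := hahn_banach (- f0) order_sup_sublinear.
pose single (i j : 'I_n) (u : tensor S T) : V := fun k l => u *+ ((k == i) && (l == j)).
have singleP i j a u v : single i j (a *: u + v) = a *: single i j u + single i j v.
  apply/funext => k; apply/funext => l; rewrite !fctE /single.
  by case: (_ && _); rewrite ?mulr1n// !mulr0n scaler0 addr0.
pose b i j x y : R[i]^o := phi (single i j (elementary x y)).
have b_bilinear i j : bilinear_for *:%R *:%R (b i j).
  split=> [y|x] a u v; rewrite /b ?linearPl ?linearPr /=;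
    by rewrite singleP linearP.
pose beta i j : bilinear_form S T := HB.pack_for {bilinear S -> T -> R[i]^o}
  (b i j) (bilinear_isBilinear.Build R[i] S T R[i]^o *:%R *:%R (b i j)
    (b_bilinear i j)).
have pairE U : matrix_pairing beta U = phi (fun i j => U i j).
  have -> : (fun i j => U i j) = \sum_i \sum_j single i j (U i j) :> V.
    apply/funext => k; apply/funext => l.
    rewrite {1}[U]matrix_sum_entry summxE !fct_sumE; apply: eq_bigr => i _.
    rewrite summxE !fct_sumE; apply: eq_bigr => j _.
    by rewrite mxE.
  rewrite linear_sum; apply: eq_bigr => i _.
  rewrite linear_sum; apply: eq_bigr => j _.
  have single_linear : linear (single i j) by move=> a u v; exact: singleP.
  have [p ->] := tensor_sumE (U i j).
  rewrite -[LHS]/(tensor_eval (beta i j) _) linear_sum.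
  pose s : {linear tensor S T -> V} := HB.pack_for {linear tensor S T -> V}
    (single i j) (GRing.isLinear.Build R[i] _ V _ _ single_linear).
  by rewrite -[single i j _]/(s _) !linear_sum.
exists beta; split.
  move=> U cU; rewrite pairE lecE /=; set f : V := fun i j => U i j.
  have adjU := tensor_cone_herm cU.
  have matN : mat (- f) = - U by apply/matrixP => i j; rewrite !mxE !fctE.
  have h1 : 0 <= complex.Re (phi f).
    have := le_trans (phi_le (- f)) (order_sup_le (a := 0) _).
    rewrite linearN /= => h; rewrite -oppr_le0.
    have -> : - complex.Re (phi f) = complex.Re (- phi f) by case: (phi f).
    apply: h; have h2 : 0 <= 2 :> R by [].
    have := tensor_coneZ h2 cU; rewrite /order_bounds /= matN.
    congr tensor_cone; apply/matrixP => i j; rewrite !mxE rmorph0 scale0r mul0rn.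
    rewrite add0r opprD opprK tensor_starN opprK.
    have := congr1 (fun M : 'M_n => M i j) adjU; rewrite !mxE => ->.
    by rewrite rmorph_nat scaler_nat mulr2n.
  (* A purely imaginary multiple of a hermitian matrix is skew-hermitian; the choices [i] and [- i]
     make the imaginary part of [phi f] vanish. *)
  have hi (c : R[i]) : complex.Re c = 0 -> complex.Re (c * phi f) <= 0.
    move=> c0; have conjE : Num.conj c = - c.
      by case: c c0 => u v /= ->; apply/eqP; rewrite eq_complex /= oppr0 !eqxx.
    have -> : c * phi f = phi (c *: f) by rewrite linearZ.
    apply: le_trans (phi_le _) _; apply/order_sup_le/order_bounds0.
    apply/matrixP => i j; rewrite !mxE !fctE tensor_starZ.
    have := congr1 (fun M : 'M_n => M i j) adjU; rewrite !mxE => ->.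
    by rewrite conjE scaleNr.
  rewrite h1 andbT; have := hi 'i%C erefl; have := hi (- 'i%C) (oppr0 R).
  by case: (phi f) => u v /=; rewrite !mul0r !mulN1r !mul1r; case: eqVneq => //; lra.
rewrite pairE lecE /= => /andP[_ h].
have : 2 * r0 <= order_sup (- f0).
  apply: lb_le_inf => [|a]; first exact: (order_bounds_has_inf _).1.
  rewrite /order_bounds /=.
  have -> : mat (- f0) = - U0 by apply/matrixP => i j; rewrite !mxE !fctE.
  move=> ca; rewrite leNgt; apply/negP => ar0; apply: U0_out.
  apply: (tensor_cone_half (t := a)); first lra.
  move: ca; congr tensor_cone; apply/matrixP => i j; rewrite !mxE.
  rewrite opprD opprK tensor_starN opprK.
  by have := congr1 (fun M : 'M_n => M i j) U0_herm; rewrite !mxE => ->.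
have {}h : 0 <= complex.Re (phi f0) by [].
have ReN z : complex.Re (- z) = - complex.Re z :> R by case: z.
by rewrite -phiE linearN ReN; move: r0_gt0 h; lra.
Qed.

End HermitianOutsideMax.
End Separation.

(** * Extension of positive pairings to the injective envelope *)

Section Pairing.
Context {R : realType} {S T : lmodType R[i]} {n : nat}.
Variable beta : 'I_n -> 'I_n -> bilinear_form S T.

Lemma matrix_pairingD (U W : 'M[tensor S T]_n) :
  matrix_pairing beta (U + W) = matrix_pairing beta U + matrix_pairing beta W.
Proof.
rewrite -big_split; apply: eq_bigr => i _.
by rewrite -big_split; apply: eq_bigr => j _; rewrite mxE.
Qed.

Lemma matrix_pairing_entry (i j : 'I_n) (u : tensor S T) :
  matrix_pairing beta (entry_mx i j u) = u (beta i j).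
Proof.
rewrite /matrix_pairing (bigD1 i) //= [X in _ + X]big1 ?addr0.
  rewrite (bigD1 j) //= big1 ?addr0 => [|l lj]; rewrite mxE ?eqxx //.
  by rewrite (negbTE lj) andbF.
move=> k ki; rewrite big1 // => l _.
by rewrite mxE (negbTE ki).
Qed.

Lemma matrix_pairing_diag (u : tensor S T) :
  matrix_pairing beta (diag_unit u n) = \sum_i (u (beta i i) : R[i]).
Proof.
apply: eq_bigr => i _; rewrite (bigD1 i) //= mxE eqxx mulr1n big1 ?addr0 //.
by move=> j ji; rewrite mxE eq_sym (negbTE ji).
Qed.

(* t = ((i, j), (b, b')) *)
Definition compressed_form k m (Q : 'M[T]_m) (A : 'M[R[i]]_(n, k * m))
    (a a' : 'I_k) (x : S) : R[i] :=
  \sum_(t : 'I_n * 'I_n * ('I_m * 'I_m))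
    A t.1.1 (mxtens_index (a, t.2.1)) *
    Num.conj (A t.1.2 (mxtens_index (a', t.2.2))) *
    beta t.1.1 t.1.2 x (Q t.2.1 t.2.2).

(** Regrouping the sum by the indices of [P] exhibits a [k] by [k] matrix of functionals on [S] that
    depends only on [Q], [A] and [beta]. Positivity in the dual of [S] will be tested on that
    matrix. *)
Lemma matrix_pairing_congr k m (P : 'M[S]_k) (Q : 'M[T]_m)
    (A : 'M[R[i]]_(n, k * m)) :
  matrix_pairing beta (mxcongr A (mx_elementary P Q)) =
  \sum_a \sum_a' compressed_form Q A a a' (P a a').
Proof.
transitivity (\sum_(ij : 'I_n * 'I_n) \sum_(aa : 'I_k * 'I_k)
    \sum_(bb : 'I_m * 'I_m) A ij.1 (mxtens_index (aa.1, bb.1)) *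
    Num.conj (A ij.2 (mxtens_index (aa.2, bb.2))) *
    beta ij.1 ij.2 (P aa.1 aa.2) (Q bb.1 bb.2)).
  rewrite /matrix_pairing pair_big; apply: eq_bigr => -[i j] _ /=.
  rewrite mxE tensor_fun_sum sum_mxtens.
  pose F a b a' b' : R[i] := A i (mxtens_index (a, b)) *
    Num.conj (A j (mxtens_index (a', b'))) * beta i j (P a a') (Q b b').
  rewrite -(pair_big xpredT xpredT (fun a a' =>
    \sum_(bb : 'I_m * 'I_m) F a bb.1 a' bb.2)) /=.
  apply: eq_bigr => a _; transitivity (\sum_a' \sum_b \sum_b' F a b a' b').
    rewrite exchange_big /=; apply: eq_bigr => b _.
    rewrite tensor_fun_sum sum_mxtens; apply: eq_bigr => a' _.
    by apply: eq_bigr => b' _; rewrite mxE !mxtens_indexK.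
  by apply: eq_bigr => a' _; rewrite pair_big.
rewrite exchange_big /= [RHS]pair_big; apply: eq_bigr => -[a a'] _ /=.
by rewrite /compressed_form pair_big.
Qed.

End Pairing.

Section Psd.
Context {R : realType}.

Lemma flatten_mx_quadratic k n (X : 'M['M[R[i]]_n]_k) (v : 'rV_(k * n)) :
  (v *m flatten_mx X *m v ^t Num.conj) 0 0 =
  \sum_c \sum_c' \sum_a \sum_a' v 0 (mxtens_index (c, a)) *
    Num.conj (v 0 (mxtens_index (c', a'))) * X c c' a a'.
Proof.
pose F c a c' a' := v 0 (mxtens_index (c, a)) *
  Num.conj (v 0 (mxtens_index (c', a'))) * X c c' a a'.
transitivity (\sum_c' \sum_a' \sum_c \sum_a F c a c' a').
  rewrite mxE sum_mxtens; apply: eq_bigr => c' _; apply: eq_bigr => a' _.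
  rewrite mxE mulr_suml sum_mxtens; apply: eq_bigr => c _; apply: eq_bigr => a _.
  by rewrite !mxE !mxtens_indexK /F; ring.
rewrite [RHS]exchange_big; apply: eq_bigr => c' _; rewrite exchange_big.
by apply: eq_bigr => c _; rewrite exchange_big.
Qed.

End Psd.

Section DualFunctionals.
Context {R : realType}.

Fact dual_linear (V : lmodType R[i]) (N : V -> R) (f : dual N) :
  linear (f : V -> R[i]^o).
Proof. by have /asboolP[] := dual_funP f. Qed.

HB.instance Definition _ (V : lmodType R[i]) (N : V -> R) (f : dual N) :=
  GRing.isLinear.Build R[i] V R[i]^o _ (dual_fun f) (dual_linear f).

Definition dual_eval (V : lmodType R[i]) (N : V -> R) (x : V) (f : dual N) :
  R[i]^o := f x.

Fact dual_eval_linear (V : lmodType R[i]) (N : V -> R) (x : V) :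
  linear (@dual_eval V N x).
Proof. by []. Qed.

HB.instance Definition _ (V : lmodType R[i]) (N : V -> R) (x : V) :=
  GRing.isLinear.Build R[i] (dual N) R[i]^o _ (@dual_eval V N x)
    (@dual_eval_linear V N x).

End DualFunctionals.

Section Slices.
Context {R : realType} {S T : operatorSystemType R} {n : nat}.
Variable beta : 'I_n -> 'I_n -> bilinear_form S T.
Hypothesis beta_pos : forall U, tensor_cone U -> 0 <= matrix_pairing beta U.

(** The pairing is nonnegative on the matrices of [tensor_cone_oblock] with [|c| = 1]. The values 1,
    -1, [i] and [- i] of [c] show that [w] is the conjugate of [z] and bound the real and imaginary
    parts of [z]. *)
Lemma slice_bounded i j y :
  (fun x => beta i j x y) \in bounded_functional (@onorm R S).
Proof.
apply/asboolP; split; first by move=> a u v; rewrite linearPl.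
have real_diag k : exists2 m : R, 0 <= m & beta k k ounit ounit = m%:C.
  have := beta_pos (tensor_cone_entry k ler01).
  rewrite matrix_pairing_entry rmorph1 scale1r lecE /= => /andP[/eqP im re].
  by exists (complex.Re (beta k k ounit ounit)) => //; apply/eqP;
    rewrite eq_complex /= im !eqxx.
have [mi mi0 miE] := real_diag i; have [mj mj0 mjE] := real_diag j.
have [s s0 ps] := oblock_mpos y.
exists (s * (mi + mj)) => x; apply: onorm_le_bound => [|r r0 pr].
  by rewrite mulr_ge0 ?addr_ge0// ltW.
set z := beta i j x y; pose w := beta j i (star x) (star y).
have h (c : R[i]) : c * Num.conj c = 1 ->
    0 <= (r * s * mi)%:C + c * z + Num.conj c * w + (r * s * mj)%:C.
  move=> c1; have := beta_pos (tensor_cone_oblock i j c pr ps).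
  rewrite !matrix_pairingD !matrix_pairing_entry c1 mul1r /=.
  by rewrite !fctE /= -![_ *: _]/(_ * _ : R[i]) miE mjE -!rmorphM.
have n1 : (1 : R[i]) * Num.conj 1 = 1 by rewrite rmorph1 mulr1.
have n2 : (-1 : R[i]) * Num.conj (-1) = 1 by rewrite rmorphN1 mulrNN mulr1.
have conji : Num.conj ('i%C : R[i]) = - 'i%C.
  by apply/eqP; rewrite eq_complex /= oppr0 !eqxx.
have conjNi : Num.conj (- 'i%C : R[i]) = 'i%C.
  by apply/eqP; rewrite eq_complex /= oppr0 opprK !eqxx.
have n3 : ('i%C : R[i]) * Num.conj 'i%C = 1.
  by rewrite conji mulrN -expr2 sqr_i opprK.
have n4 : (- 'i%C : R[i]) * Num.conj (- 'i%C) = 1.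
  by rewrite conjNi mulNr -expr2 sqr_i opprK.
have := h _ n1; have := h _ n2; have := h _ n3; have := h _ n4.
rewrite rmorph1 rmorphN1 conjNi conji !lecE /=.
case: z h => z1 z2 _; case: w => w1 w2 /=.
move=> /andP[/eqP a1 a2] /andP[/eqP b1 b2] /andP[/eqP c1 c2] /andP[/eqP d1 d2].
set K := s * (mi + mj) * r.
have K0 : 0 <= K by rewrite !mulr_ge0 ?addr_ge0// ltW.
(* Each part of [z] is at most [K / 2] in absolute value, so the modulus of [z] is at most [K]. *)
have E1 : - K <= 2 * z1 <= K by rewrite /K; nra.
have E2 : - K <= 2 * z2 <= K by rewrite /K; nra.
rewrite -(ler_sqr (sqrtr_ge0 _))// sqr_sqrtr; nra.
Qed.

Definition slice i j y : odual S := Dual (slice_bounded i j y).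

Lemma sliceP i j a y z : slice i j (a *: y + z) = a *: slice i j y + slice i j z.
Proof. by apply: val_inj; apply/funext => x /=; rewrite linearPr. Qed.

End Slices.

Section Extension.
Context {R : realType} {S E T : operatorSystemType R}.
Variables (kappa : {linear S -> E}) (Psi : {linear E -> obidual S}).
Hypotheses (Psi_cp : completely_positive mpos (@obidual_mpos R S) Psi)
  (Psi_kappa : forall s, Psi (kappa s) = canonical_inclusion s).

Lemma matrix_pairing_extension n (beta : 'I_n -> 'I_n -> bilinear_form S T) :
  (forall U, tensor_cone U -> 0 <= matrix_pairing beta U) ->
  exists beta' : 'I_n -> 'I_n -> bilinear_form E T,
    (forall U, tensor_cone U -> 0 <= matrix_pairing beta' U) /\
    forall U, matrix_pairing beta' (map_mx (tensor_map kappa (@idfun T)) U) =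
      matrix_pairing beta U.
Proof.
move=> beta_pos.
pose sl := slice beta_pos.
pose b i j (x : E) (y : T) : R[i]^o := Psi x (sl i j y).
have b_bilinear i j : bilinear_for *:%R *:%R (b i j).
  split=> [y|x] a u v; rewrite /b; first by rewrite linearP.
  by rewrite /sl sliceP linearP.
pose beta' i j : bilinear_form E T := HB.pack_for {bilinear E -> T -> R[i]^o}
  (b i j) (bilinear_isBilinear.Build R[i] E T R[i]^o *:%R *:%R (b i j)
    (b_bilinear i j)).
exists beta'; split; last first.
  move=> U; apply: eq_bigr => i _; apply: eq_bigr => j _; rewrite mxE.
  have [p ->] := tensor_sumE (U i j).
  rewrite linear_sum !tensor_fun_sum; apply: eq_bigr => xy _ /=.
  by rewrite /b Psi_kappa.
move=> _ [k [m [P [Q [A [pP pQ ->]]]]]].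
(* The matrix of compressed forms of [beta], now with entries in the dual of [S], to which [Psi] can
   be applied. *)
pose G : 'M[odual S]_k := \matrix_(a, a') \sum_(t : 'I_n * 'I_n * ('I_m * 'I_m))
    (A t.1.1 (mxtens_index (a, t.2.1)) *
    Num.conj (A t.1.2 (mxtens_index (a', t.2.2)))) *:
    sl t.1.1 t.1.2 (Q t.2.1 t.2.2).
have GE a a' x : G a a' x = compressed_form beta Q A a a' x.
  by rewrite mxE -[LHS]/(dual_eval x _) linear_sum.
have G_pos : odual_mpos G.
  move=> p X pX v; rewrite flatten_mx_quadratic.
  (* Contracting [A] with the test vector [v] turns the quadratic form of [G] at [X] into the
     pairing of [beta] with the compression of [mx_elementary X Q] by [B]. *)
  pose B : 'M[R[i]]_(n, p * m) := \matrix_(i, q) \sum_a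
    v 0 (mxtens_index ((mxtens_unindex q).1, a)) *
    A i (mxtens_index (a, (mxtens_unindex q).2)).
  have : tensor_cone (mxcongr B (mx_elementary X Q)) by exists p, m, X, Q, B.
  move=> /beta_pos; rewrite matrix_pairing_congr.
  congr (0 <= _); apply: eq_bigr => c _; apply: eq_bigr => c' _.
  transitivity (\sum_(t : 'I_n * 'I_n * ('I_m * 'I_m)) \sum_a \sum_a'
    v 0 (mxtens_index (c, a)) * Num.conj (v 0 (mxtens_index (c', a'))) *
    (A t.1.1 (mxtens_index (a, t.2.1)) *
    Num.conj (A t.1.2 (mxtens_index (a', t.2.2))) *
    beta t.1.1 t.1.2 (X c c') (Q t.2.1 t.2.2))).
    apply: eq_bigr => t _; rewrite !mxE !mxtens_indexK /= rmorph_sum.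
    rewrite big_distrlr /= mulr_suml; apply: eq_bigr => a _.
    by rewrite mulr_suml; apply: eq_bigr => a' _; rewrite rmorphM; ring.
  rewrite exchange_big; apply: eq_bigr => a _.
  rewrite exchange_big; apply: eq_bigr => a' _.
  by rewrite [map_mx _ _ _ _]mxE mxE GE mulr_sumr.
(* At the vector that sums [e_a] tensor [e_a], the quadratic form is the sum of
   [Psi (P a a') (G a a')], which is the pairing with [beta']. *)
pose v : 'rV[R[i]]_(k * k) :=
  \row_q ((mxtens_unindex q).1 == (mxtens_unindex q).2)%:R.
have vE c a : v 0 (mxtens_index (c, a)) = (a == c)%:R.
  by rewrite mxE !mxtens_indexK eq_sym.
have := Psi_cp pP G_pos v; rewrite flatten_mx_quadratic matrix_pairing_congr.
congr (0 <= _); apply: eq_bigr => a _; apply: eq_bigr => a' _.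
rewrite (bigD1 a) //= [X in _ + X]big1 ?addr0 => [|c ca]; last first.
  by rewrite big1 // => c' _; rewrite vE (negbTE ca) !mul0r.
rewrite (bigD1 a') //= big1 ?addr0 => [|c' ca]; last first.
  by rewrite [v _ (mxtens_index (a', _))]vE (negbTE ca) rmorph0 mulr0 mul0r.
rewrite !vE !eqxx mul1r rmorph1 mul1r !mxE linear_sum.
by apply: eq_bigr => t _; rewrite linearZ.
Qed.

End Extension.

(** * Comparison of the two tensor structures *)

Lemma tensor_cone_map (R : realType) (S E T : operatorSystemType R)
    (f : {linear S -> E}) n (U : 'M[tensor S T]_n) :
  completely_positive mpos mpos f -> tensor_cone U ->
  tensor_cone (map_mx (tensor_map f (@idfun T)) U).
Proof.
move=> cpf [k [m [P [Q [A [pP pQ ->]]]]]].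
exists k, m, (map_mx f P), Q, A; split=> //; first exact: cpf.
rewrite !mxcongrE map_mxsandwich; congr mxsandwich.
by apply/matrixP => p q; rewrite !mxE /= tensor_map_elementary.
Qed.

Lemma max_mposE (R : realType) (S T : operatorSystemType R) n
    (U : 'M[tensor S T]_n) :
  max_mpos U <-> forall r : R, 0 < r ->
    tensor_cone (diag_unit (r%:C *: elementary ounit ounit) n + U).
Proof.
by split=> h r /h [k [m [P [Q [A [pP pQ E]]]]]]; exists k, m, P, Q, A; split=> //;
  rewrite addrC.
Qed.

Lemma map_diag_unit (R : realType) (V W : lmodType R[i]) (f : {linear V -> W})
    (v : V) n : map_mx f (diag_unit v n) = diag_unit (f v) n.
Proof. by apply/matrixP => i j; rewrite !mxE raddfMn. Qed.

Theorem theorem6p7 (R : realType) (S : operatorSystemType R) :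
  has_WEP S -> el_max_nuclear S.
Proof.
move=> [E0 [kappa0 [[[cp0 kappa0_1] E0_inj _] [Phi Phi_cp Phi_kappa]]]].
move=> E kappa [[kappa_coe kappa1] _ _] T.
have kappa_cp : completely_positive mpos mpos kappa by move=> n X /kappa_coe.
have kappa_star := cp_star kappa_cp kappa1.
have kappa_inj : injective kappa.
  apply: raddf_inj => s ks0; have ms x : kappa x = 0 -> mpos 1 (const_mx x).
    move=> x0; apply/kappa_coe; rewrite map_const_mx x0.
    rewrite -[const_mx 0]/(0 : 'M_1); exact: mpos0.
  have := mpos_proper _ _ (ms _ ks0).
  have -> : - const_mx s = const_mx (- s) :> 'M_1.
    by apply/matrixP => i j; rewrite !mxE.
  have ns0 : kappa (- s) = 0 by rewrite linearN ks0 oppr0.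
  by move=> /(_ (ms _ ns0)) /matrixP /(_ 0 0); rewrite !mxE.
(* The weak expectation is given on one envelope [E0], whereas [E] is arbitrary. Injectivity of [E0]
   extends [kappa0] along [kappa], and [Phi] after this extension serves for [E]. *)
have [psi psi_cp psi_kappa] :=
  E0_inj S E kappa (conj kappa_coe kappa1) kappa0 (fun n X => (cp0 n X).1).
pose Psi : {linear E -> obidual S} := (Phi \o psi : E -> obidual S).
have Psi_cp : completely_positive mpos (@obidual_mpos R S) Psi.
  by move=> n X /psi_cp/Phi_cp; rewrite -map_mx_comp.
have Psi_kappa s : Psi (kappa s) = canonical_inclusion s.
  by rewrite /= psi_kappa Phi_kappa.
have unit_map n (r : R) :
    map_mx (tensor_map kappa (@idfun T))
      (diag_unit (r%:C *: elementary ounit ounit) n) =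
    diag_unit (r%:C *: elementary ounit ounit) n.
  by rewrite map_diag_unit linearZ /= tensor_map_elementary kappa1.
split; last first.
  exists idfun; split=> // n U /max_mposE cU; rewrite map_mx_id//.
  apply/(max_mposE (map_mx _ U)) => r r0; rewrite -unit_map -map_mxD.
  exact: tensor_cone_map (cU r r0).
move=> n U elU; rewrite map_mx_id//; apply/max_mposE => r r0.
have {elU} cU := (max_mposE (map_mx _ U)).1 elU.
(* Membership in the cone is known only after adding a multiple of the unit to the image of [U].
   Hermiticity of that sum is pulled back through the injective map, and the hermitian unit is
   cancelled. *)
have U_herm : tensor_adj U = U.
  apply: (addrI (diag_unit (1%:C *: elementary ounit ounit) n)).
  rewrite -{1}(tensor_cone_herm (tensor_cone_unit n ler01)) -tensor_adjD.
  apply/matrixP => i j; apply: (tensor_map_inj kappa_inj).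
  have := tensor_cone_herm (cU 1 ltr01).
  rewrite -unit_map -map_mxD; set W := _ + U => /matrixP /(_ i j).
  by rewrite [tensor_adj _ i j]mxE ![map_mx _ _ _ _]mxE !mxE tensor_map_star.
apply: contrapT => U_out.
have [beta [beta_pos beta_U]] := hermitian_separation r0 U_herm U_out.
have [beta' [beta'_pos beta'E]] :=
  matrix_pairing_extension Psi_cp Psi_kappa beta_pos.
apply: beta_U.
rewrite -beta'E.
have pair_unit (r' : R) : matrix_pairing beta'
    (diag_unit (r'%:C *: elementary ounit ounit) n) =
    r'%:C * \sum_i beta i i ounit ounit.
  by rewrite -unit_map beta'E matrix_pairing_diag mulr_sumr.
have := beta_pos _ (tensor_cone_unit n ler01).
rewrite rmorph1 scale1r matrix_pairing_diag /=.
move: pair_unit; set c := \sum_i _ => pair_unit.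
rewrite lecE /= => /andP[/eqP c1 c2].
have h (r' : R) (r'0 : 0 < r') := beta'_pos _ (cU r' r'0).
move: h; set z := matrix_pairing beta' (map_mx _ U) => h.
(* It remains to let [r'] tend to 0. The value [d / (c1 + 1)] makes the error at most [d], also when
   [c1 = 0]. *)
have {}h (r' : R) : 0 < r' -> 0 <= r'%:C * c + z.
  by move=> /h; rewrite matrix_pairingD pair_unit.
case: c z c1 c2 {pair_unit} h => [c1 ?] [z1 z2] /= -> c0 h.
have := h 1 ltr01; rewrite !lecE /= => /andP[/eqP zim _].
apply/andP; split; first by apply/eqP; move: zim; lra.
apply/ler_addgt0Pr => d d0.
have c10 : 0 < c1 + 1 by lra.
have := h (d / (c1 + 1)) (divr_gt0 d0 c10); rewrite lecE /= => /andP[_].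
have : d / (c1 + 1) * c1 <= d.
  by rewrite mulrAC ler_pdivrMr//; nra.
lra.
Qed.
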